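(* Let $G=(V,E,\phi)$ be an undirected graph with $n=|V|$ vertices, $m=|E|$ edges, maximum vertex degree $\Delta$, and non-negative vertex weights $\phi:V\to\mathbb{R}_{\ge 0}$. The Two-Thirds approximation algorithm described in the context runs in time $O(m\log\Delta + n\log n)$.
   Context: Matching notions: a matching $M$ is a set of edges no two of which share an endpoint; a vertex is matched if it is an endpoint of an edge of $M$, otherwise unmatched. An $M$-augmenting path is a path whose edges alternate between edges not in $M$ and edges in $M$ and whose two endpoints are unmatched; augmenting means replacing $M$ by the symmetric difference $M\oplus P$. The Two-Thirds approximation algorithm: sort the vertices in non-increasing order of weight (ties broken consistently) into a queue $Q$, and set $M=\emptyset$. While $Q\neq\emptyset$: remove the first (heaviest) vertex $u$ from $Q$; among all unmatched vertices $v$ reachable from $u$ by an $M$-augmenting path $P$ of length (number of edges) at most three, choose a heaviest one; if such a path exists, set $M\gets M\oplus P$ and remove $v$ from $Q$. Output the final $M$. *)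

(* Defs.v *)
From HB Require Import structures.
From mathcomp Require Import all_boot all_order all_algebra.
From mathcomp Require Import reals exp.

Set Implicit Arguments.
Unset Strict Implicit.
Unset Printing Implicit Defensive.

Import Order.TTheory GRing.Theory Num.Theory.

(** * Graphs, matchings and augmenting paths *)

Section Graph.
Variable V : finType.
Implicit Types (E M : {set {set V}}) (u v x : V) (s : seq V).

(* A finite simple undirected graph on V is its set of edges, an edge being a
   two-element set of vertices. *)
Definition simple_graph E : Prop := forall e, e \in E -> #|e| = 2.

Definition degree E v : nat := #|[set e in E | v \in e]|.

Definition max_degree E : nat := \max_(v : V) degree E v.

Definition unmatched M v : bool := v \notin cover M.

(* A path is given by its first vertex u and the sequence s of its other
   vertices; its length is size s. *)
Definition path_edges u s : seq {set V} := pairmap (fun x y => [set x; y]) u s.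

(* A path that has two endpoints has at least one edge, whence s != [::]. *)
Definition augmenting E M u s : bool :=
  [&& s != [::],
      uniq (u :: s),
      all [in E] (path_edges u s),
      sorted (fun e f => (e \in M) != (f \in M)) (path_edges u s),
      unmatched M u
    & unmatched M (last u s)].

Definition augment M u s : {set {set V}} :=
  let P := [set:: path_edges u s] in (M :\: P) :|: (P :\: M).

(** * The Two-Thirds algorithm *)

Variables (R : realType) (w : V -> R).

(* [vs] lists the vertices in the order of their numbers.  A single order is
   used in all comparisons, both for sorting the queue and for selecting the
   heaviest endpoint: vertices of equal weight are ordered by number.  As the
   numbering is arbitrary, so is this rule for breaking ties. *)
Definition heavier (vs : seq V) : rel V := fun u v =>
  (w v < w u)%R || (w v == w u) && (index u vs <= index v vs).

Definition short_augmenting E M u s : bool :=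
  augmenting E M u s && (size s <= 3).

(* [run E vs Q M tr M']: from queue Q and matching M the loop can end with
   matching M', the successive iterations being recorded in tr.  The record
   of an iteration is (u, s), where u is the vertex that it takes from the
   queue and s is the path from u along which it augments ([::] if there is no
   such path). *)
Inductive run E (vs : seq V) :
    seq V -> {set {set V}} -> seq (V * seq V) -> {set {set V}} -> Prop :=
| run_done M : run E vs [::] M [::] M
| run_augment u Q M s tr M' :
    short_augmenting E M u s ->
    (forall s', short_augmenting E M u s' ->
       heavier vs (last u s) (last u s')) ->
    run E vs (rem (last u s) Q) (augment M u s) tr M' ->
    run E vs (u :: Q) M ((u, s) :: tr) M'
| run_fail u Q M tr M' :
    (forall s', ~~ short_augmenting E M u s') ->
    run E vs Q M tr M' ->
    run E vs (u :: Q) M ((u, [::]) :: tr) M'.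

Definition two_thirds E (vs : seq V) (tr : seq (V * seq V)) M : Prop :=
  run E vs (sort (heavier vs) vs) set0 tr M.

End Graph.

(** * Machine model

   A random access machine with unit cost.  It has registers and finitely many
   (the program is finite) arrays, all holding natural numbers, a write-only
   tape, and a read-only array of real weights that it can only compare.  The
   only arithmetic is successor and predecessor, so that t steps enlarge the
   numbers in memory by at most t, up to a constant: the unit cost does not
   hide any computation on long words. *)

Inductive instr : Type :=
| Const of nat & nat          (* x := k       *)
| Copy of nat & nat           (* x := y       *)
| Incr of nat                 (* x := x + 1   *)
| Decr of nat                 (* x := x - 1   *)
| Read of nat & nat & nat     (* x := a[y]    *)
| Write of nat & nat & nat    (* a[x] := y    *)
| Emit of nat.                (* append x to the tape *)

Inductive test : Type :=
| TEq of nat & nat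
| TLt of nat & nat
| TWle of nat & nat           (* weight[x] <= weight[y] *)
| TNot of test
| TAnd of test & test.

Inductive cmd : Type :=
| Do of instr
| Seq of cmd & cmd
| If of test & cmd & cmd
| While of test & cmd.

Record state : Type := State {
  reg : nat -> nat;
  arr : nat -> nat -> nat;
  tape : seq nat
}.

Definition upd {T : Type} (f : nat -> T) (x : nat) (a : T) : nat -> T :=
  fun y => if y == x then a else f y.

Definition set_reg (st : state) (x a : nat) : state :=
  State (upd (reg st) x a) (arr st) (tape st).

Definition exec_instr (i : instr) (st : state) : state :=
  match i with
  | Const x k => set_reg st x k
  | Copy x y => set_reg st x (reg st y)
  | Incr x => set_reg st x (reg st x).+1
  | Decr x => set_reg st x (reg st x).-1
  | Read x a y => set_reg st x (arr st a (reg st y))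
  | Write a x y =>
      State (reg st) (upd (arr st) a (upd (arr st a) (reg st x) (reg st y)))
        (tape st)
  | Emit x => State (reg st) (arr st) (rcons (tape st) (reg st x))
  end.

Section Exec.
Variables (R : realType) (wt : seq R).

Fixpoint eval (b : test) (st : state) : bool :=
  match b with
  | TEq x y => reg st x == reg st y
  | TLt x y => reg st x < reg st y
  | TWle x y => (nth 0 wt (reg st x) <= nth 0 wt (reg st y))%R
  | TNot b1 => ~~ eval b1 st
  | TAnd b1 b2 => eval b1 st && eval b2 st
  end.

(* [exec c st k st']: started in st, the program c halts in st' after k steps.
   A test costs one step, as it makes a number of comparisons that depends
   only on the program. *)
Inductive exec : cmd -> state -> nat -> state -> Prop :=
| exec_do i st : exec (Do i) st 1 (exec_instr i st)
| exec_seq c1 c2 st k1 st1 k2 st2 :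
    exec c1 st k1 st1 -> exec c2 st1 k2 st2 ->
    exec (Seq c1 c2) st (k1 + k2) st2
| exec_if b c1 c2 st k st' :
    exec (if eval b st then c1 else c2) st k st' ->
    exec (If b c1 c2) st k.+1 st'
| exec_while_end b c st :
    ~~ eval b st -> exec (While b c) st 1 st
| exec_while_loop b c st k1 st1 k2 st2 :
    eval b st -> exec c st k1 st1 -> exec (While b c) st1 k2 st2 ->
    exec (While b c) st (k1 + k2).+1 st2.

Lemma exec_det c st k1 st1 k2 st2 :
  exec c st k1 st1 -> exec c st k2 st2 -> k1 = k2 /\ st1 = st2.
Proof.
move=> H; elim: H k2 st2 => {c st k1 st1}.
- by move=> i st k2 st2 H; inversion H.
- move=> c1 c2 st k1 st1 k2 st2 _ IH1 _ IH2 k st' H.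
  inversion H as [|? ? ? l1 t1 l2 t2 E1 E2| | |]; subst.
  have [e1 e2] := IH1 _ _ E1; subst.
  by have [-> ->] := IH2 _ _ E2.
- move=> b c1 c2 st k st' _ IH k2 st2 H.
  inversion H as [| |? ? ? ? l ? E1| |]; subst.
  by have [-> ->] := IH _ _ E1.
- move=> b c st Hb k2 st2 H.
  inversion H as [| | | |? ? ? ? ? ? ? Eb]; subst => //.
  by rewrite Eb in Hb.
- move=> b c st k1 st1 k2 st2 Hb _ IH1 _ IH2 k st' H.
  inversion H as [| | |? ? ? Eb|? ? ? l1 t1 l2 t2 Eb E1 E2]; subst.
    by rewrite Hb in Eb.
  have [e1 e2] := IH1 _ _ E1; subst.
  by have [-> ->] := IH2 _ _ E2.
Qed.

End Exec.

(** * Input and output *)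

Section InputOutput.
Variable V : finType.
Implicit Types (E M : {set {set V}}) (vs : seq V) (adj : V -> seq V).

(* The graph is given by a numbering of its vertices and by adjacency lists,
   both in arbitrary order. *)
Definition adjacency_lists E vs adj : Prop :=
  perm_eq vs (enum V) /\
  forall v : V, uniq (adj v) /\
    forall x : V, (x \in adj v) = ([set v; x] \in E).

(* Register 0 holds the number of vertices.  Array 1 holds the concatenated
   adjacency lists, and array 0 the position where each list starts, then the
   total length. *)
Definition input vs adj : state :=
  let lists := [seq [seq index x vs | x <- adj v] | v <- vs] in
  let start := mkseq (fun i => sumn (take i (shape lists))) (size vs).+1 in
  State (fun x => if x == 0 then size vs else 0)
        (fun a => if a == 0 then nth 0 start
                  else if a == 1 then nth 0 (flatten lists)
                  else fun=> 0)
        [::].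

Definition encode_trace vs (tr : seq (V * seq V)) : seq nat :=
  flatten [seq [:: index it.1 vs, size it.2 & [seq index x vs | x <- it.2]]
          | it <- tr].

(* An entry of the array is 0 for an unmatched vertex, and otherwise one plus
   the number of the vertex it is matched with. *)
Definition mate_array vs M (a : nat -> nat) : Prop :=
  forall v : V,
    (unmatched M v -> a (index v vs) = 0) /\
    (forall x : V, [set v; x] \in M -> a (index v vs) = (index x vs).+1).

(* The program must carry out the algorithm, and not merely compute its result
   in some other way: it writes on the tape, in order, the vertex handled and
   the path used by every iteration.  It leaves the final matching in
   array 2. *)
Definition performs_two_thirds (R : realType) (c : cmd) E (w : V -> R) vs adj
    (k : nat) : Prop :=
  exists (st : state) (tr : seq (V * seq V)) (M : {set {set V}}),
    [/\ exec [seq w v | v <- vs] c (input vs adj) k st,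
        two_thirds w E vs tr M,
        tape st = encode_trace vs tr
      & mate_array vs M (arr st 2)].

End InputOutput.

(* Main.v *)
(* Vertices never become unmatched, and a vertex that the loop has failed to
   match stays without a short augmenting path, so every short augmenting path
   ends at a vertex that is still in the queue.  The search from u therefore
   needs, for a neighbour a that is matched with b, only the heaviest neighbour
   of b in the queue.  Each vertex keeps its neighbours in a stack, heaviest on
   top, and discards the ones that have left the queue when it is asked; each
   entry is discarded once, so all searches cost O(n + m).  The stacks come from
   pushing the vertices on the stacks of their neighbours in the order opposite
   to that of the queue, in O(n + m), after a merge sort of the queue in
   O(n log n).  Finally m <= m log D / log 2 if D >= 2, and 2m <= n otherwise. *)

Require Import Defs.
From mathcomp Require Import all_boot all_order all_algebra.
From mathcomp Require Import reals exp.
From mathcomp Require Import zify ring lra.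

Set Implicit Arguments.
Unset Strict Implicit.
Unset Printing Implicit Defensive.

Import Order.TTheory GRing.Theory Num.Theory.

(** * Total correctness with running time *)

Section ProgramLogic.
Variables (R : realType) (wt : seq R).

(** The machine can only step its numbers by one, so midpoints and list lengths are out of reach.
    The sort is therefore a bottom-up merge over runs delimited by the sentinel [n]; the same number
    later marks the end of a stack and the absence of a candidate. The queue is never edited either:
    a vertex leaves it by a mark in [aDead] and is skipped when met, and the predicate [al] of alive
    vertices stands for the queue in all invariants. That short paths end at alive vertices rests on
    reversal: such a path read backwards starts at its end, which therefore has not failed. The cost
    of one search depends on how many stale entries it discards, so the specifications bound the
    number of steps plus four times [potential], the total height of the stacks. As [exec] relates a
    program only to states in which it halts, an existential [wp] expresses total correctness, and
    its postcondition receives the exact step count. *)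

Definition wp (c : cmd) (Q : nat -> state -> Prop) (st : state) : Prop :=
  exists k st', exec wt c st k st' /\ Q k st'.

Lemma wp_do i (Q : nat -> state -> Prop) st :
  Q 1 (exec_instr i st) -> wp (Do i) Q st.
Proof. by move=> HQ; exists 1, (exec_instr i st); split => //; constructor. Qed.

Lemma wp_seq c1 c2 Q st :
  wp c1 (fun k1 s1 => wp c2 (fun k2 s2 => Q (k1 + k2) s2) s1) st ->
  wp (Seq c1 c2) Q st.
Proof.
move=> [k1 [s1 [H1 [k2 [s2 [H2 HQ]]]]]].
by exists (k1 + k2), s2; split => //; apply: exec_seq H1 H2.
Qed.

Lemma wp_if b c1 c2 Q st :
  wp (if eval wt b st then c1 else c2) (fun k => Q k.+1) st ->
  wp (If b c1 c2) Q st.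
Proof.
by move=> [k [s [H HQ]]]; exists k.+1, s; split => //; constructor.
Qed.

Lemma wp_while_end b c (Q : nat -> state -> Prop) st :
  ~~ eval wt b st -> Q 1 st -> wp (While b c) Q st.
Proof. by move=> Hb HQ; exists 1, st; split => //; constructor. Qed.

Lemma wp_while_loop b c Q st :
  eval wt b st ->
  wp c (fun k1 s1 => wp (While b c) (fun k2 s2 => Q (k1 + k2).+1 s2) s1) st ->
  wp (While b c) Q st.
Proof.
move=> Hb [k1 [s1 [H1 [k2 [s2 [H2 HQ]]]]]].
by exists (k1 + k2).+1, s2; split => //; apply: exec_while_loop H1 H2.
Qed.

Definition instr_reg i : seq nat :=
  match i with
  | Const x _ | Copy x _ | Incr x | Decr x | Read x _ _ => [:: x]
  | Write _ _ _ | Emit _ => [::]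
  end.

Definition instr_arr i : seq nat := if i is Write a _ _ then [:: a] else [::].

Definition instr_emits i : bool := if i is Emit _ then true else false.

Fixpoint written_regs c : seq nat :=
  match c with
  | Do i => instr_reg i
  | Seq c1 c2 | If _ c1 c2 => written_regs c1 ++ written_regs c2
  | While _ c => written_regs c
  end.

Fixpoint written_arrs c : seq nat :=
  match c with
  | Do i => instr_arr i
  | Seq c1 c2 | If _ c1 c2 => written_arrs c1 ++ written_arrs c2
  | While _ c => written_arrs c
  end.

Fixpoint emits c : bool :=
  match c with
  | Do i => instr_emits i
  | Seq c1 c2 | If _ c1 c2 => emits c1 || emits c2
  | While _ c => emits c
  end.

(** The footprint is read off the syntax, so that loop specifications list only what changes.
    Untouched arrays are equal as functions, which lets whole array predicates be transported by
    rewriting. *)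
Definition frame c st st' : Prop :=
  [/\ forall x, x \notin written_regs c -> reg st' x = reg st x,
      forall a, a \notin written_arrs c -> arr st' a = arr st a
    & ~~ emits c -> tape st' = tape st].

Lemma frame_reg c st st' x :
  frame c st st' -> x \notin written_regs c -> reg st' x = reg st x.
Proof. by case=> + _ _; apply. Qed.

Lemma frame_arr c st st' a :
  frame c st st' -> a \notin written_arrs c -> arr st' a = arr st a.
Proof. by case=> _ + _; apply. Qed.

Lemma frame_tape c st st' :
  frame c st st' -> ~~ emits c -> tape st' = tape st.
Proof. by case. Qed.

Lemma exec_frame c st k st' : exec wt c st k st' -> frame c st st'.
Proof.
elim=> {c st k st'} [i st|c1 c2 st k1 st1 k2 st2 _ [r1 a1 t1] _ [r2 a2 t2]
  |b c1 c2 st k st' _|b c st _|b c st k1 st1 k2 st2 _ _ [r1 a1 t1] _ [r2 a2 t2]].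
- split; case: i => //= *; rewrite /upd; case: eqP => // e; subst;
    by match goal with H : is_true (_ \notin _) |- _ => rewrite inE eqxx in H end.
- split=> /= [x|x|]; rewrite ?mem_cat ?negb_or => /andP[h1 h2].
  + by rewrite r2 ?r1.
  + by rewrite a2 ?a1.
  + by rewrite t2 ?t1.
- case: (eval _ _ _) => -[r a t]; split=> /= [x|x|];
    rewrite ?mem_cat ?negb_or => /andP[h1 h2]; by [rewrite r|rewrite a|rewrite t].
- by split.
- split=> /= [x h|x h|h].
  + by rewrite r2 ?r1.
  + by rewrite a2 ?a1.
  + by rewrite t2 ?t1.
Qed.

(** Each use of a specification also receives the frame of the command, so no loop invariant has to
    mention the cells that it leaves alone. *)
Lemma wp_conseq c (Q Q' : nat -> state -> Prop) st :
  wp c Q st -> (forall k st', frame c st st' -> Q k st' -> Q' k st') ->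
  wp c Q' st.
Proof.
move=> [k [s [H HQ]]] HI; exists k, s; split=> //.
by apply: HI => //; apply: exec_frame H.
Qed.

End ProgramLogic.

(** * Augmenting paths of length at most three *)

Section ShortAugmentingPaths.
Variables (V : finType) (E : {set {set V}}).
Hypothesis simpE : simple_graph E.
Implicit Types (M : {set {set V}}) (u v x y : V) (s : seq V).

Lemma set2_eq (a b x y : V) :
  ([set a; b] == [set x; y]) =
  (a == x) && (b == y) || (a == y) && (b == x).
Proof.
apply/eqP/idP => [/setP e|/orP[]/andP[/eqP-> /eqP->] //]; last exact: setUC.
have := e a; have := e b; have := e x; have := e y; rewrite !inE !eqxx /=.
rewrite (eq_sym x) (eq_sym y) (eq_sym x b) (eq_sym y b) !orbT.
by case: eqP; case: eqP; case: eqP; case: eqP.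
Qed.

Lemma edge_neq x y : [set x; y] \in E -> x != y.
Proof. by move=> /simpE; rewrite cards2; case: (x == y). Qed.

(** Disjointness of edges is phrased as uniqueness of the partner, the form in which an array of
    mates represents a matching. *)
Definition matching M : Prop :=
  M \subset E /\
  forall v x y, [set v; x] \in M -> [set v; y] \in M -> x = y.

Lemma unmatchedP M v : M \subset E ->
  reflect (forall x, [set v; x] \notin M) (unmatched M v).
Proof.
move=> /subsetP sub; apply: (iffP idP) => [um x|um].
  by apply: contra um => ?; apply/bigcupP; exists [set v; x]; rewrite ?set21.
apply/negP => /bigcupP[e eM ve]; have /eqP/cards2P[a [b [ab e_ab]]] := simpE (sub _ eM).
move: ve; rewrite {e}e_ab in eM *; rewrite !inE => /orP[]/eqP e_v; rewrite e_v in um.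
  by have := um b; rewrite eM.
by have := um a; rewrite setUC eM.
Qed.

Lemma unmatched_edge M v x : [set v; x] \in M ->
  ~~ unmatched M v /\ ~~ unmatched M x.
Proof.
by move=> h; split; rewrite negbK; apply/bigcupP; exists [set v; x];
  rewrite ?set21 ?set22.
Qed.

(** Among the distinctness conditions of a path of length three only [c != u] has to be stated:
    neighbours differ by simplicity, and the other pairs consist of a matched and an unmatched
    vertex. *)
Inductive short_path M u : seq V -> Prop :=
| ShortPath1 v : [set u; v] \in E -> unmatched M u -> unmatched M v ->
    short_path M u [:: v]
| ShortPath3 a b c : [set u; a] \in E -> [set a; b] \in M -> [set b; c] \in E ->
    unmatched M u -> unmatched M c -> c != u -> short_path M u [:: a; b; c].

(** The first and last edges touch unmatched vertices, hence lie outside [M]. Alternation then rules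
    out length two and forces the middle edge of a path of length three into [M]. *)
Lemma short_augmentingP M u s : M \subset E ->
  short_augmenting E M u s <-> short_path M u s.
Proof.
move=> sub; split; last first.
  case=> [v uv uu uv'|a b c ua ab bc uu uc cu]; rewrite /short_augmenting /augmenting /=.
    by rewrite inE (negbTE (edge_neq uv)) uv uu uv'.
  have [na nb] := unmatched_edge ab; have abE := subsetP sub _ ab.
  rewrite !inE !negb_or ua bc abE uu uc /= ab !andbT.
  rewrite (edge_neq ua) (edge_neq abE) (edge_neq bc) (eq_sym u c) cu.
  have -> : u != b by apply: contraNneq nb => <-.
  have -> : a != c by apply: contraNneq na => ->.
  have /negbTE-> : [set u; a] \notin M by apply/unmatchedP.
  have /negbTE-> : [set b; c] \notin M by rewrite setUC; apply/unmatchedP.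
  by [].
rewrite /short_augmenting /augmenting.
case: s => [|a [|b [|c [|? ?]]]] //=; last by rewrite !ltnS !andbF.
- by move=> /andP[/and4P[_ /andP[e _] uu ua] _]; constructor.
- move=> /andP[/and4P[_ _ /andP[alt _] /andP[uu ub]] _].
  have /negbTE e1 : [set u; a] \notin M by apply/unmatchedP.
  have /negbTE e2 : [set a; b] \notin M by rewrite setUC; apply/unmatchedP.
  by rewrite e1 e2 in alt.
- rewrite !andbT !inE => /and4P[un /and3P[e1 e2 e3] /andP[a1 a2] /andP[uu uc]].
  have /negbTE f1 : [set u; a] \notin M by apply/unmatchedP.
  rewrite f1 in a1; apply: ShortPath3 => //; first by case: (_ \in M) a1.
  by move: un; rewrite (eq_sym c); case: (u == c); rewrite // !orbT.
Qed.

Lemma short_path_rev M u s : short_path M u s ->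
  exists s', short_path M (last u s) s' /\ last (last u s) s' = u.
Proof.
case=> [v uv uu uv'|a b c ua ab bc uu uc cu] /=.
  by exists [:: u]; split=> //; constructor; rewrite // setUC.
by exists [:: b; a; u]; split=> //; apply: ShortPath3; rewrite // 1?setUC // eq_sym.
Qed.

Lemma short_path_last M u s : short_path M u s ->
  unmatched M (last u s) /\ last u s != u.
Proof.
case=> //= v uv uu uv'; split=> //.
by rewrite eq_sym edge_neq.
Qed.

Lemma mem_augment1 M u v x y : unmatched M u -> M \subset E ->
  ([set x; y] \in augment M u [:: v]) =
  ([set x; y] == [set u; v]) || ([set x; y] \in M).
Proof.
move=> uu sub; rewrite /augment !inE /=.
have uvM : [set u; v] \notin M by apply/unmatchedP.
by case: (eqVneq [set x; y] [set u; v]) => [->|]; rewrite ?(negbTE uvM) //= andbF orbF.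
Qed.

Lemma mem_augment3 M u a b c x y :
  short_path M u [:: a; b; c] -> M \subset E ->
  ([set x; y] \in augment M u [:: a; b; c]) =
  [|| [set x; y] == [set u; a], [set x; y] == [set b; c] |
     ([set x; y] \in M) && ([set x; y] != [set a; b])].
Proof.
move=> h sub; inversion h as [|? ? ? ua ab bc uu uc cu]; subst.
rewrite /augment !inE /=.
have uaM : [set u; a] \notin M by apply/unmatchedP.
have bcM : [set b; c] \notin M by rewrite setUC; apply/unmatchedP.
case: (eqVneq [set x; y] [set u; a]) => [->|_]; first by rewrite (negbTE uaM).
case: (eqVneq [set x; y] [set b; c]) => [->|_].
  by rewrite (negbTE bcM) orbT.
case: (eqVneq [set x; y] [set a; b]) => [->|_]; first by rewrite ab.
by rewrite /= !(andbT, andbF, orbF).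
Qed.

Lemma augment_sub M u s : short_path M u s -> M \subset E ->
  augment M u s \subset E.
Proof.
move=> h sub; apply/subsetP => e; rewrite /augment !inE => /orP[/andP[_]|].
  exact: (subsetP sub).
move=> /andP[_]; case: h => [v uv _ _|a b c ua ab bc _ _ _]; rewrite /= !inE.
  by move=> /eqP->.
by move=> /or3P[]/eqP-> //; apply: (subsetP sub).
Qed.

Lemma augment_matching M u s : short_path M u s -> matching M ->
  matching (augment M u s).
Proof.
move=> h [sub mM]; split; first exact: augment_sub.
move=> v x y; case: h (h) => [z uz uu uz'|a b c ua ab bc uu uc cu] h.
  rewrite !mem_augment1 // !set2_eq.
  move: uu uz' => /(unmatchedP _ sub) uu /(unmatchedP _ sub) uz'.
  have nzu : z == u = false by rewrite eq_sym; apply: negbTE (edge_neq uz).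
  case: (eqVneq v u) => [->|_].
    by rewrite (eq_sym u) nzu (negbTE (uu _)) (negbTE (uu _)) /= !orbF
      => /eqP-> /eqP->.
  case: (eqVneq v z) => [->|_ /=]; last exact: mM.
  by rewrite (negbTE (uz' _)) (negbTE (uz' _)) /= !orbF => /eqP-> /eqP->.
rewrite !mem_augment3 // !set2_eq.
have [na nb] := unmatched_edge ab; have nab := edge_neq (subsetP sub _ ab).
have nua := edge_neq ua; have nbc := edge_neq bc.
have nub : u != b by apply: contraNneq nb => <-.
have nac : a != c by apply: contraNneq na => ->.
move: uu uc => /(unmatchedP _ sub) uu /(unmatchedP _ sub) uc.
case: (eqVneq v u) => [->|_].
  rewrite (negbTE (uu _)) (negbTE (uu _)) (negbTE nua) (negbTE nub) (eq_sym u c) (negbTE cu).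
  by rewrite /= !orbF => /eqP-> /eqP->.
case: (eqVneq v c) => [->|_].
  rewrite (negbTE (uc _)) (negbTE (uc _)) (eq_sym c a) (negbTE nac) (eq_sym c b) (negbTE nbc).
  by rewrite /= !orbF => /eqP-> /eqP->.
case: (eqVneq v a) => [->|_].
  (* The only partner of [a] in [M] was [b], and that edge has been removed; [b] is treated in the
     same way below. *)
  have H z : ([set a; z] \in M) && ~~ (z == b) = false.
    by apply/negP => /andP[/(mM _ _ _ ab) <-]; rewrite eqxx.
  rewrite (negbTE nab) /= !orbF !H !orbF.
  by move=> /eqP-> /eqP->.
case: (eqVneq v b) => [->|_] /=.
  have H z : ([set b; z] \in M) && ~~ (z == a) = false.
    by apply/negP => /andP[]; rewrite setUC in ab; move=> /(mM _ _ _ ab) <-; rewrite eqxx.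
  rewrite /= !orbF !H !orbF.
  by move=> /eqP-> /eqP->.
by rewrite !andbT; apply: mM.
Qed.

Lemma augment_unmatched M u s x : short_path M u s -> M \subset E ->
  unmatched (augment M u s) x = [&& unmatched M x, x != u & x != last u s].
Proof.
move=> h sub; have sub' := augment_sub h sub.
apply/(unmatchedP _ sub')/idP => [um|/and3P[/(unmatchedP _ sub) um xu xl] y].
  apply/and3P; split.
  - apply/(unmatchedP _ sub) => y; apply/negP => xyM.
    case: h um => [z uz uu uz'|a b c ua ab bc uu uc cu] um.
      by have := um y; rewrite mem_augment1 // xyM orbT.
    have h : short_path M u [:: a; b; c] by apply: ShortPath3.
    have := um y; rewrite mem_augment3 // xyM /= !negb_or negbK => /and3P[_ _].
    rewrite set2_eq => /orP[]/andP[/eqP ex _].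
      by have := um u; rewrite mem_augment3 // !set2_eq ex !eqxx orbT.
    by have := um c; rewrite mem_augment3 // !set2_eq ex !eqxx /= !orbT.
  - apply/eqP => ex; case: h um => [z uz uu uz'|a b c ua ab bc uu uc cu] um.
      by have := um z; rewrite mem_augment1 // ex eqxx.
    have h : short_path M u [:: a; b; c] by apply: ShortPath3.
    by have := um a; rewrite mem_augment3 // ex eqxx.
  - apply/eqP => ex; case: h um ex => [z uz uu uz'|a b c ua ab bc uu uc cu] um /= ex.
      by have := um u; rewrite mem_augment1 // ex setUC eqxx.
    have h : short_path M u [:: a; b; c] by apply: ShortPath3.
    by have := um b; rewrite mem_augment3 // ex setUC eqxx orbT.
case: h (h) xl => [z uz uu uz'|a b c ua ab bc uu uc cu] h /= xl.
  by rewrite mem_augment1 // set2_eq (negbTE xu) (negbTE xl) (negbTE (um y)).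
rewrite mem_augment3 // !set2_eq (negbTE xu) (negbTE xl) (negbTE (um y)) /= orbF.
have -> : x == a = false.
  by apply: contraTF ab => /eqP<-.
have -> : x == b = false.
  by apply: contraTF ab => /eqP<-; rewrite setUC.
by [].
Qed.

Definition failed M u : Prop := forall s, ~ short_path M u s.

(* A path from [f] that becomes available by augmenting along a path [P] meets
   [P], and then [f] had already a path that ends at an endpoint of [P]. *)
Lemma augment_failed M u s f : matching M -> short_path M u s ->
  failed M f -> failed (augment M u s) f.
Proof.
move=> [sub mM] h ff s' h'.
have um x : unmatched (augment M u s) x -> unmatched M x.
  by rewrite (augment_unmatched _ h sub) => /and3P[].
have noedge a : [set f; a] \in E -> unmatched M f -> ~~ unmatched M a.
  by move=> fa fu; apply/negP => au; apply: (ff [:: a]); constructor.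
case: h' => [v fv uf uv|a b c fa ab bc uf uc cf].
  by have := noedge _ fv (um _ uf); rewrite (um _ uv).
have /negP na := noedge _ fa (um _ uf).
have [] := (um _ uf, um _ uc) => uf' uc'.
have sub' := augment_sub h sub.
case: (boolP ([set a; b] \in M)) => [abM|nabM].
  by apply: (ff [:: a; b; c]); apply: ShortPath3.
have [fu fl] : f != u /\ f != last u s.
  by move: uf; rewrite (augment_unmatched _ h sub) => /and3P[].
case: h (h) ab fl => [z uz uu uz'|p q z up pq qz uu uz zu] h ab fl.
  move: ab; rewrite mem_augment1 // (negbTE nabM) orbF set2_eq.
  by case/orP => /andP[/eqP ea _]; apply: na; rewrite ea.
move: ab; rewrite mem_augment3 // (negbTE nabM) orbF !set2_eq.
(* The middle edge [ab] is one of the two new edges. If [a] is an end of the old path, the edge [fa]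
   alone was a path from [f]; if [a] is [p] or [q], the old path followed from there gives [p, q, z]
   or [q, p, u]. *)
have fup : unmatched M f -> [set f; p] \notin E.
  move=> fu'; apply/negP => fp; apply: (ff [:: p; q; z]); apply: ShortPath3 => //.
  by rewrite eq_sym.
have fuq : unmatched M f -> [set f; q] \notin E.
  move=> fu'; apply/negP => fp; apply: (ff [:: q; p; u]).
  by apply: ShortPath3; rewrite // 1?setUC // eq_sym.
case/orP => /orP[]/andP[/eqP ea _].
- by apply: na; rewrite ea.
- by have := fup uf'; rewrite -ea fa.
- by have := fuq uf'; rewrite -ea fa.
- by apply: na; rewrite ea.
Qed.

End ShortAugmentingPaths.

(** * The program *)

Declare Scope cmd_scope.
Delimit Scope cmd_scope with cmd.
Bind Scope cmd_scope with cmd.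
Notation "c1 ;; c2" := (Seq c1 c2)
  (at level 90, right associativity) : cmd_scope.
Coercion Do : instr >-> cmd.

(** [rN] and [r0] are never written and hold [n] and [0]. Memory starts at zero, which already
    encodes the empty matching, empty stacks and no dead vertex; [rT] counts allocated cells and is
    incremented before use, so cell 0 stays free. *)
Notation rN := 0 (only parsing).
Notation rI := 1 (only parsing).
Notation rJ := 2 (only parsing).
Notation rE := 3 (only parsing).
Notation rA := 4 (only parsing).
Notation rB := 5 (only parsing).
Notation rGo := 6 (only parsing).
Notation rK := 7 (only parsing).
Notation rU := 8 (only parsing).
Notation rP := 9 (only parsing).
Notation rQ := 10 (only parsing).
Notation rV := 11 (only parsing).
Notation rT := 12 (only parsing).
Notation rH := 13 (only parsing).
Notation rX := 14 (only parsing).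
Notation r0 := 15 (only parsing).
Notation rBest := 16 (only parsing).
Notation rVia := 17 (only parsing).
Notation rM := 18 (only parsing).
Notation rD := 19 (only parsing).
Notation rS := 20 (only parsing).
Notation aStart := 0 (only parsing).
Notation aAdj := 1 (only parsing).
Notation aMate := 2 (only parsing).
Notation aRuns := 3 (only parsing).
Notation aDead := 4 (only parsing).
Notation aOwner := 5 (only parsing).
Notation aNext := 6 (only parsing).
Notation aHead := 7 (only parsing).

(* The weight read at the sentinel rN is the default 0, so that the sentinel
   comes after all vertices. *)
Definition before x y : test :=
  TNot (TAnd (TWle x y) (TNot (TAnd (TWle y x) (TNot (TLt y x))))).

(* Array aRuns holds the queue of sorted runs that are still to be merged, each
   followed by the sentinel rN, from cell rI to cell rE.  It starts with an
   empty run, so that the queue is nonempty even if there is no vertex. *)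
Definition singletons_loop : cmd :=
  While (TLt rA rN)
    (Write aRuns rE rA;; Incr rE;; Write aRuns rE rN;; Incr rE;; Incr rA).

Definition singletons : cmd := (Write aRuns rE rN;; Incr rE;; singletons_loop)%cmd.

Definition scan_loop : cmd :=
  While (TNot (TEq rA rN)) (Incr rJ;; Read rA aRuns rJ).

(** Finds where the second run begins. If that position is [rE], a single run is left and
    [sort_loop] stops. *)
Definition scan : cmd :=
  (Copy rJ rI;; Read rA aRuns rJ;; scan_loop;; Incr rJ)%cmd.

(** An exhausted run shows the sentinel, which loses against every vertex, so no separate loop
    copies the remainder. The output goes to fresh cells at [rE], never over the runs being read. *)
Definition merge_loop : cmd :=
  While (TNot (TAnd (TEq rA rN) (TEq rB rN)))
    (If (before rA rB)
       (Write aRuns rE rA;; Incr rI;; Read rA aRuns rI)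
       (Write aRuns rE rB;; Incr rJ;; Read rB aRuns rJ);;
     Incr rE).

Definition merge_runs : cmd :=
  (Read rA aRuns rI;; Read rB aRuns rJ;; merge_loop;;
   Write aRuns rE rN;; Incr rE;; Copy rI rJ;; Incr rI)%cmd.

Definition sort_loop : cmd :=
  While (TNot (TEq rGo r0)) (scan;; If (TLt rJ rE) merge_runs (Const rGo 0)).

(* A stack is a linked list of cells; cell 0 ends all lists and its owner is the
   sentinel. *)
Definition push_loop : cmd :=
  While (TLt rP rQ)
    (Read rV aAdj rP;; Incr rT;; Read rH aHead rV;; Write aNext rT rH;;
     Write aOwner rT rU;; Write aHead rV rT;; Incr rP).

Definition stacks_loop : cmd :=
  While (TLt rI rK)
    (Decr rK;; Read rU aRuns rK;; Read rP aStart rU;; Incr rU;;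
     Read rQ aStart rU;; Decr rU;; push_loop).

(** There is no emptiness test: at the end of a stack the owner read is the sentinel, which is never
    marked dead. *)
Definition pop_loop : cmd :=
  While (TNot (TEq rD r0))
    (Read rH aNext rH;; Read rX aOwner rH;; Read rD aDead rX).

Definition pop : cmd :=
  (Read rH aHead rM;; Read rX aOwner rH;; Read rD aDead rX;; pop_loop;;
   Write aHead rM rH)%cmd.

(** Only the first inner vertex [rVia] and the end [rBest] are remembered, as the mate of [rVia]
    determines the rest of the path. [Copy rS rS] is a no-op, for want of a skip command. *)
Definition search_loop : cmd :=
  While (TLt rP rQ)
    (Read rV aAdj rP;; Read rM aMate rV;;
     If (TEq rM r0) (Copy rX rV) (Decr rM;; pop);;
     If (before rX rBest) (Copy rBest rX;; Copy rVia rV) (Copy rS rS);;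
     Incr rP).

(** The value 1 in [rD] serves twice: as the mark of a dead vertex, then as the length of a path
    with one edge. *)
Definition augment_cmd : cmd :=
  (Const rD 1;; Write aDead rBest rD;; Read rM aMate rVia;;
   Copy rS rU;; Incr rS;;
   If (TEq rM r0)
     (Emit rD;; Emit rBest;; Write aMate rBest rS;;
      Copy rQ rBest;; Incr rQ;; Write aMate rU rQ)
     (Decr rM;; Const rD 3;; Emit rD;; Emit rVia;; Emit rM;; Emit rBest;;
      Write aMate rVia rS;; Copy rQ rVia;; Incr rQ;; Write aMate rU rQ;;
      Copy rQ rM;; Incr rQ;; Write aMate rBest rQ;;
      Copy rQ rBest;; Incr rQ;; Write aMate rM rQ))%cmd.

(** Marking [u] dead before the search does more than remove it from the queue: it prevents the
    stacks from proposing [u] itself as the end of a path of length three. *)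
Definition handle : cmd :=
  (Const rD 1;; Write aDead rU rD;; Read rP aStart rU;; Copy rS rU;; Incr rS;;
   Read rQ aStart rS;; Copy rBest rN;; search_loop;;
   Emit rU;; If (TEq rBest rN) (Emit r0) augment_cmd)%cmd.

Definition main_loop : cmd :=
  While (TNot (TEq rU rN))
    (Read rD aDead rU;; If (TEq rD r0) handle (Copy rS rS);;
     Incr rK;; Read rU aRuns rK).

Definition sort_cmd : cmd := (singletons;; Const rGo 1;; sort_loop)%cmd.

(** After sorting, [rJ] is just past the sentinel of the last run. Decrementing its copy gives the
    end of the queue, from which the stacks are filled backwards. *)
Definition two_thirds_cmd : cmd :=
  (sort_cmd;; Write aOwner r0 rN;; Copy rK rJ;; Decr rK;; stacks_loop;;
   Copy rK rI;; Read rU aRuns rK;; main_loop)%cmd.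

(** * Sorting *)

Fixpoint segment (f : nat -> nat) p s : Prop :=
  if s is x :: s' then f p = x /\ segment f p.+1 s' else True.

Arguments segment : simpl never.

Lemma segment_cons f p x s :
  segment f p (x :: s) <-> f p = x /\ segment f p.+1 s.
Proof. by []. Qed.

Lemma segment_cat f p s1 s2 :
  segment f p (s1 ++ s2) <-> segment f p s1 /\ segment f (p + size s1) s2.
Proof.
elim: s1 p => [|x s1 IH] p /=; first by rewrite addn0; split=> // -[].
by rewrite !segment_cons IH addnS addSn; tauto.
Qed.

(** Agreement is asked on all cells below the end of the word, which suits memory that is only ever
    written at its growing end [rE]. *)
Lemma segment_ext f g p s :
  (forall i, i < p + size s -> g i = f i) -> segment f p s -> segment g p s.
Proof.
elim: s p => [|x s IH] p //= H /segment_cons[<- h]; split; first by apply: H; lia.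
by apply: IH h => i hi; apply: H; lia.
Qed.

Lemma upd_other (T : Type) (f : nat -> T) x a y : y != x -> upd f x a y = f y.
Proof. by rewrite /upd => /negbTE->. Qed.

#[global] Arguments upd {T} f x a y /.

Ltac step :=
  first [apply: wp_seq | apply: wp_do]; rewrite /=.

Ltac steps := repeat step.

Section Machine.
Variables (R : realType) (V : finType) (E : {set {set V}}) (w : V -> R).
Variables (vs : seq V) (adj : V -> seq V).
Hypothesis simpE : simple_graph E.
Hypothesis w_ge0 : forall v, (0 <= w v)%R.
Hypothesis adjP : adjacency_lists E vs adj.

Local Notation wt := [seq w v | v <- vs].
Local Notation n := (size vs).
Local Notation ix := (fun v : V => index v vs).
Implicit Types (u v x y : V) (r : seq V) (st : state).
Local Notation hv := (heavier w vs).
Local Notation wpw := (wp wt).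

(** * Vertex numbers and the weight order as tested by the machine *)

Lemma mem_vs v : v \in vs.
Proof. by rewrite (perm_mem adjP.1) mem_enum. Qed.

Lemma uniq_vs : uniq vs.
Proof. by rewrite (perm_uniq adjP.1) enum_uniq. Qed.

Lemma ix_lt v : index v vs < n.
Proof. by rewrite index_mem mem_vs. Qed.

Lemma ix_neq v : (index v vs == n) = false.
Proof. by have := ix_lt v; lia. Qed.

Lemma ix_eq u v : (index u vs == index v vs) = (u == v).
Proof.
apply/eqP/eqP => [|-> //] e.
by rewrite -(nth_index u (mem_vs u)) e nth_index // mem_vs.
Qed.

Lemma wt_ix v : nth 0%R wt (index v vs) = w v.
Proof. by rewrite (nth_map v) ?ix_lt // nth_index // mem_vs. Qed.

Lemma hv_total : total hv.
Proof.
move=> u v; rewrite /heavier; case: (ltgtP (w u) (w v)) => //= _.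
exact: leq_total.
Qed.

Lemma hv_trans : transitive hv.
Proof.
move=> v u x; rewrite /heavier.
case: (ltgtP (w u) (w v)) => //= [h1|h1];
case: (ltgtP (w v) (w x)) => //= [h2|h2].
- by rewrite (lt_trans h2 h1).
- by rewrite -h2 h1.
- by rewrite h1 h2.
- by rewrite h1 h2 eqxx ltxx /=; apply: leq_trans.
Qed.

(** Breaking ties by number makes the sorted list unique, so the machine's merge sort must produce
    the very list [sort hv vs] of the specification. *)
Lemma hv_anti : antisymmetric hv.
Proof.
move=> u v; rewrite /heavier; case: (ltgtP (w u) (w v)) => //= _.
by rewrite -eqn_leq ix_eq => /eqP.
Qed.

Definition beforeb (a b : nat) : bool :=
  ~~ ((nth 0 wt a <= nth 0 wt b)%R
      && ~~ ((nth 0 wt b <= nth 0 wt a)%R && ~~ (b < a))).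

Lemma eval_before (x y : nat) st : eval wt (before x y) st = beforeb (reg st x) (reg st y).
Proof. by []. Qed.

Lemma beforeb_ix u v : beforeb (index u vs) (index v vs) = hv u v.
Proof.
rewrite /beforeb /heavier !wt_ix -leqNgt.
by case: (ltgtP (w u) (w v)); rewrite ?negbK.
Qed.

(** Non-negativity of the weights enters here: the sentinel reads the default weight [0], and a
    vertex of weight [0] wins the tie because its number is below [n]. *)
Lemma beforeb_n u : beforeb (index u vs) n.
Proof.
rewrite /beforeb wt_ix nth_default ?size_map // w_ge0 /=.
by rewrite negb_and negbK -leqNgt (ltnW (ix_lt u)) orbT.
Qed.

Lemma n_beforeb u : beforeb n (index u vs) = false.
Proof.
rewrite /beforeb wt_ix nth_default ?size_map // w_ge0 /= negbK.
by rewrite ix_lt andbF.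
Qed.

Lemma scan_loop_spec r st : reg st rN = n ->
  segment (arr st aRuns) (reg st rJ) (rcons (map ix r) n) ->
  reg st rA = arr st aRuns (reg st rJ) ->
  wpw scan_loop (fun k st' => k <= 3 * size r + 1 /\
                   reg st' rJ = reg st rJ + size r) st.
Proof.
elim: r st => [|x r IH] st hN /= /segment_cons[hs1 hs2] hA.
  apply: wp_while_end; first by rewrite /= hA hs1 hN eqxx.
  by split=> //; rewrite addn0.
apply: wp_while_loop.
  by rewrite /= hA hs1 hN ix_neq.
steps; apply: wp_conseq (IH _ _ _ _) _ => //=.
by move=> k st' _ [h1 h2]; split; lia.
Qed.

Lemma scan_spec r st : reg st rN = n ->
  segment (arr st aRuns) (reg st rI) (rcons (map ix r) n) ->
  wpw scan (fun k st' => k <= 3 * size r + 4 /\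
              reg st' rJ = reg st rI + (size r).+1) st.
Proof.
move=> hN hs; steps; apply: wp_conseq (scan_loop_spec (r := r) _ _ _) _ => //=.
by move=> k st' _ [h1 h2]; steps; split; lia.
Qed.

Lemma merge_loop_spec (r1 r2 : seq V) st :
  reg st rN = n ->
  segment (arr st aRuns) (reg st rI) (rcons (map ix r1) n) ->
  segment (arr st aRuns) (reg st rJ) (rcons (map ix r2) n) ->
  reg st rI + size r1 < reg st rE -> reg st rJ + size r2 < reg st rE ->
  reg st rA = arr st aRuns (reg st rI) -> reg st rB = arr st aRuns (reg st rJ) ->
  wpw merge_loop (fun k st' =>
    [/\ k <= 6 * (size r1 + size r2) + 1,
        reg st' rJ = reg st rJ + size r2,
        reg st' rE = reg st rE + (size r1 + size r2),
        segment (arr st' aRuns) (reg st rE) (map ix (merge hv r1 r2))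
      & forall i, i < reg st rE -> arr st' aRuns i = arr st aRuns i]) st.
Proof.
have [m] := ubnP (size r1 + size r2); elim: m => // m IH in r1 r2 st *.
move=> hm hN h1 h2 l1 l2 hA hB.
have wr f e a p s : p + size s < e.+1 -> segment f p s -> segment (upd f e a) p s.
  by move=> hp; apply: segment_ext => i hi; rewrite upd_other //; lia.
have hd (r : seq V) st' p : segment (arr st' aRuns) p (rcons (map ix r) n) ->
    arr st' aRuns p = if r is x :: _ then index x vs else n.
  by case: r => [|x r] /segment_cons[].
have [ev|ne] := boolP (eval wt (TAnd (TEq rA rN) (TEq rB rN)) st).
  have /andP[/= /eqP e1 /eqP e2] := ev.
  rewrite hA hN (hd _ _ _ h1) in e1; rewrite hB hN (hd _ _ _ h2) in e2.
  case: r1 e1 {h1 l1 hm} => [_|x1 r1 e1]; last by have := ix_neq x1; rewrite e1 eqxx.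
  case: r2 e2 {h2 l2} => [_|x2 r2 e2]; last by have := ix_neq x2; rewrite e2 eqxx.
  apply: wp_while_end; last by rewrite /=; split=> //; lia.
  exact/negPn.
apply: wp_while_loop => //; apply: wp_seq; apply: wp_if.
rewrite eval_before hA hB.
(* Each branch is proved from an equation on [merge] alone, so that it covers both a won comparison
   and the exhaustion of the other run. *)
have left (x1 : V) (r1' : seq V) : r1 = x1 :: r1' -> merge hv r1 r2 = x1 :: merge hv r1' r2 ->
   wpw (Write aRuns rE rA;; Incr rI;; Read rA aRuns rI)
     (fun k1 s1 => wpw (Incr rE) (fun k2 s2 => wpw merge_loop (fun k st' =>
    [/\ ((k1.+1 + k2) + k).+1 <= 6 * (size r1 + size r2) + 1,
        reg st' rJ = reg st rJ + size r2,
        reg st' rE = reg st rE + (size r1 + size r2),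
        segment (arr st' aRuns) (reg st rE) (map ix (merge hv r1 r2))
      & forall i, i < reg st rE -> arr st' aRuns i = arr st aRuns i]) s2) s1) st.
  move=> e1 em; rewrite em e1 in h1 l1 hm *.
  move: h1; rewrite /= in l1 hm *; move=> /segment_cons[h1 h1'].
  steps; apply: wp_conseq (IH r1' r2 _ _ _ _ _ _ _ _ _) _ => //=;
    try lia; try (apply: wr => //; rewrite size_rcons size_map; lia).
  - by rewrite ifN //; lia.
  - move=> k st' _ [hk hJ hE hs hf]; split=> //; try lia.
    + split=> //; rewrite hf //= eqxx hA; exact: h1.
    + by move=> i hi; rewrite hf /= 1?ifN //; lia.
have right (x2 : V) (r2' : seq V) : r2 = x2 :: r2' -> merge hv r1 r2 = x2 :: merge hv r1 r2' ->
   wpw (Write aRuns rE rB;; Incr rJ;; Read rB aRuns rJ)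
     (fun k1 s1 => wpw (Incr rE) (fun k2 s2 => wpw merge_loop (fun k st' =>
    [/\ ((k1.+1 + k2) + k).+1 <= 6 * (size r1 + size r2) + 1,
        reg st' rJ = reg st rJ + size r2,
        reg st' rE = reg st rE + (size r1 + size r2),
        segment (arr st' aRuns) (reg st rE) (map ix (merge hv r1 r2))
      & forall i, i < reg st rE -> arr st' aRuns i = arr st aRuns i]) s2) s1) st.
  move=> e2 em; rewrite em e2 in h2 l2 hm *.
  move: h2; rewrite /= in l2 hm *; move=> /segment_cons[h2 h2'].
  steps; apply: wp_conseq (IH r1 r2' _ _ _ _ _ _ _ _ _) _ => //=;
    try lia; try (apply: wr => //; rewrite size_rcons size_map; lia).
  - by rewrite ifN //; lia.
  - move=> k st' _ [hk hJ hE hs hf]; split=> //; try lia.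
    + split=> //; rewrite hf //= eqxx hB; exact: h2.
    + by move=> i hi; rewrite hf /= 1?ifN //; lia.
move: ne; rewrite /= hA hB hN (hd _ _ _ h1) (hd _ _ _ h2).
case: r1 r2 left right {hm h1 h2 l1 l2} => [|x1 r1] [|x2 r2] left right.
- by rewrite !eqxx.
- by rewrite n_beforeb => _; apply: right.
- by rewrite beforeb_n => _; apply: left => //; case: (r1).
- rewrite beforeb_ix => _; case: ifP => hx; [apply: left|apply: right];
    by rewrite //= hx.
Qed.

(** * Bottom-up merge sort on a queue of runs *)

Definition tape_of (rs : seq (seq V)) : seq nat :=
  flatten [seq rcons (map ix r) n | r <- rs].

Lemma tape_of_cons r rs : tape_of (r :: rs) = rcons (map ix r) n ++ tape_of rs.
Proof. by []. Qed.

Lemma tape_of_cat rs1 rs2 : tape_of (rs1 ++ rs2) = tape_of rs1 ++ tape_of rs2.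
Proof. by rewrite /tape_of map_cat flatten_cat. Qed.

Lemma size_tape_of_cons r rs : size (tape_of (r :: rs)) = (size r).+1 + size (tape_of rs).
Proof. by rewrite tape_of_cons size_cat size_rcons size_map. Qed.

Lemma merge_runs_spec r1 r2 (rs : seq (seq V)) st : reg st rN = n ->
  segment (arr st aRuns) (reg st rI) (tape_of [:: r1, r2 & rs]) ->
  reg st rE = reg st rI + size (tape_of [:: r1, r2 & rs]) ->
  reg st rJ = reg st rI + (size r1).+1 ->
  wpw merge_runs (fun k st' =>
    [/\ k <= 6 * (size r1 + size r2) + 7,
        segment (arr st' aRuns) (reg st' rI) (tape_of (rs ++ [:: merge hv r1 r2]))
      & reg st' rE = reg st' rI + size (tape_of (rs ++ [:: merge hv r1 r2]))]) st.
Proof.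
rewrite !tape_of_cons => hN /segment_cat[h1 /segment_cat[h2 h3]].
rewrite !size_cat !size_rcons !size_map in h2 h3 * => hE hJ.
steps; apply: wp_conseq (merge_loop_spec (r1 := r1) (r2 := r2) _ _ _ _ _ _ _) _ => //=; try lia.
  by rewrite hJ.
move=> k st' fr [hk hJ' hE' hm hf].
have hI : reg st' rJ = reg st rI + size r1 + size r2 + 1 by rewrite hJ' /=; lia.
have hN' : reg st' rN = n by rewrite (frame_reg fr).
steps; split; first lia; last first.
  rewrite hE' hE /= tape_of_cat size_cat size_tape_of_cons size_merge size_cat /=; lia.
rewrite tape_of_cat hI; apply/segment_cat; split.
  rewrite addn1.
  have -> : (reg st 1 + size r1 + size r2).+2 = reg st 1 + (size r1).+1 + (size r2).+1 by lia.
  apply: segment_ext h3 => i hi; rewrite /= ifN; last by rewrite hE' hE /=; lia.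
  by apply: hf => /=; lia.
rewrite tape_of_cons cats0 -cats1; apply/segment_cat; rewrite size_map size_merge size_cat.
have -> : (reg st 1 + size r1 + size r2 + 1).+1 + size (tape_of rs) = reg st rE by lia.
split; last by apply/segment_cons; rewrite /= hE' eqxx hN'.
apply: segment_ext hm => i; rewrite size_map size_merge size_cat => hi.
by rewrite /= ifN // hE' /=; lia.
Qed.

(* The runs in [rs1] are those that the current pass has not merged yet; after
   that pass at most [2 ^ d] runs are left. *)
Lemma sort_loop_spec d (rs1 rs2 : seq (seq V)) N st :
  reg st rN = n -> reg st r0 = 0 -> reg st rGo != 0 ->
  ~~ odd (size rs1) -> 0 < size (rs1 ++ rs2) ->
  size rs2 + (size rs1)./2 <= 2 ^ d ->
  segment (arr st aRuns) (reg st rI) (tape_of (rs1 ++ rs2)) ->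
  reg st rE = reg st rI + size (tape_of (rs1 ++ rs2)) ->
  all (sorted hv) (rs1 ++ rs2) -> perm_eq (flatten (rs1 ++ rs2)) vs ->
  size (tape_of (rs1 ++ rs2)) <= N ->
  wpw sort_loop (fun k st' =>
    [/\ k <= 16 * (size (tape_of rs1) + d * N) + 16 * N,
        segment (arr st' aRuns) (reg st' rI) (rcons (map ix (sort hv vs)) n)
      & reg st' rJ = reg st' rI + n.+1]) st.
Proof.
(* The outer induction is on the passes that remain, the inner one on the runs that the current pass
   still has to merge. In the bound, the cells of [rs1] pay for this pass, [d * N] for later ones,
   and the last [16 * N] for the final scan. *)
have [b] := ubnP d; elim: b => // b IHd in d rs1 rs2 st *.
have [m] := ubnP (size rs1); elim: m => // m IHm in rs1 rs2 st *.
case: rs1 => [|r1 [|r2 rs1]] hm hb hN h0 hGo hodd hpos hsz hs hE ho hp hle //.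
  case: d => [|d] in hb hsz IHm *; last first.
    (* A new pass begins. If the number of runs is odd, the last one counts as already merged, so
       half the number of runs, rounded up, is left. *)
    pose p := (size rs2)./2.*2.
    have hp2 : p <= size rs2 by rewrite /p; lia.
    have e : take p rs2 ++ drop p rs2 = rs2 := cat_take_drop p rs2.
    apply: wp_conseq (IHd d (take p rs2) (drop p rs2) st _ _ _ _ _ _ _ _ _ _ _ _) _;
      rewrite ?e //.
    - by rewrite size_takel // /p odd_double.
    - rewrite size_takel // size_drop /p doubleK.
      by move: hsz; rewrite /= expnS; lia.
    - move=> k st' _ [hk h1 h2]; split=> //; apply: leq_trans hk _.
      have : size (tape_of (take p rs2)) <= N.
        by move: hle; rewrite cat0s -{1}e tape_of_cat size_cat; lia.
      by rewrite mulSn /=; lia.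
  case: rs2 hm hodd hpos hsz hs hE ho hp hle => [|r [|? ?]] //= _ _ _ _ hs hE.
  rewrite !andbT => ho /permPl hp hle.
  have er : sort hv vs = r.
    apply: (sorted_eq hv_trans hv_anti) => //; first exact: sort_sorted hv_total _.
    by rewrite perm_sort perm_sym; apply/permPl; move: hp; rewrite cats0.
  have sr : size r = n by rewrite -er size_sort.
  rewrite tape_of_cons cats0 in hs hle; rewrite size_tape_of_cons addn0 in hE.
  rewrite size_rcons size_map in hle.
  apply: wp_while_loop; first by rewrite /= h0.
  apply: wp_seq; apply: wp_conseq (scan_spec (r := r) hN _) _ => //.
  move=> k st' fr [hk hJ]; apply: wp_if.
  rewrite ifF; last by rewrite /= hJ (frame_reg fr) // hE; lia.
  apply: wp_do; apply: wp_while_end; first by rewrite /= (frame_reg fr) // h0.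
  rewrite /= er; split; first by lia.
    by rewrite (frame_reg fr) // (frame_arr fr).
  by rewrite hJ (frame_reg fr) // sr.
  apply: wp_while_loop; first by rewrite /= h0.
  apply: wp_seq; apply: wp_conseq (scan_spec (r := r1) hN _) _.
    by move: hs; rewrite tape_of_cons => /segment_cat[].
  move=> k st' fr [hk hJ]; apply: wp_if.
  have [f1 f0 f15 f6 f3] : [/\ reg st' rI = reg st rI, reg st' rN = n,
     reg st' r0 = 0, reg st' rGo != 0 & reg st' rE = reg st rE].
    by split; rewrite (frame_reg fr).
  have fT : arr st' aRuns = arr st aRuns by rewrite (frame_arr fr).
  rewrite ifT; last by rewrite /= hJ f3 hE size_tape_of_cons /= size_tape_of_cons; lia.
  rewrite !cat_cons in hs hE ho hp hle.
  apply: wp_conseq (merge_runs_spec (r1 := r1) (r2 := r2) (rs := rs1 ++ rs2) f0 _ _ _) _;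
    rewrite ?f1 ?fT ?f3 //.
  move=> k' st2 fr2 [hk' hs' hE'].
  rewrite -catA in hs' hE'.
  rewrite !size_tape_of_cons in hle.
  (* A merge saves one sentinel, so the bound [N] on the size of the queue persists. *)
  have hsm : size (tape_of (rs1 ++ rs2 ++ [:: merge hv r1 r2])) + 1 =
             (size r1).+1 + ((size r2).+1 + size (tape_of (rs1 ++ rs2))).
    by rewrite !tape_of_cat !size_cat size_rcons size_map size_merge size_cat /=; lia.
  apply: wp_conseq (IHm rs1 (rs2 ++ [:: merge hv r1 r2]) st2 _ _ _ _ _ _ _ _ _ _ _ _ _) _ => //.
  - by move: hm => /=; lia.
  - by rewrite (frame_reg fr2).
  - by rewrite (frame_reg fr2).
  - by rewrite (frame_reg fr2).
  - by move: hodd; rewrite /= negbK.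
  - by rewrite !size_cat /=; lia.
  - by move: hsz; rewrite size_cat /=; lia.
  - move: ho => /= /and3P[o1 o2]; rewrite !all_cat /= => /andP[-> ->].
    by rewrite merge_sorted //; exact: hv_total.
  - apply: perm_trans hp; rewrite !flatten_cat /= cats0 catA perm_catC catA.
    rewrite flatten_cat !catA perm_cat2r perm_cat2r.
    exact/permPl/perm_merge.
  - by lia.
  - move=> k3 st3 _ [hk3 hs3 hJ3]; split=> //.
    rewrite !size_tape_of_cons; lia.
Qed.

Definition singles (s : seq V) : seq (seq V) := [::] :: [seq [:: v] | v <- s].

Lemma singletons_loop_spec (s1 s2 : seq V) st : vs = s1 ++ s2 ->
  reg st rN = n -> reg st rA = size s1 ->
  segment (arr st aRuns) 0 (tape_of (singles s1)) ->
  reg st rE = size (tape_of (singles s1)) ->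
  wpw singletons_loop (fun k st' =>
    [/\ k <= 6 * size s2 + 1, segment (arr st' aRuns) 0 (tape_of (singles vs))
      & reg st' rE = size (tape_of (singles vs))]) st.
Proof.
elim: s2 s1 st => [|x s2 IH] s1 st evs hN hA hs hE.
  apply: wp_while_end; first by rewrite /= hA hN evs cats0 -leqNgt.
  by split=> //; rewrite [X in singles X]evs cats0.
apply: wp_while_loop; first by rewrite /= hA hN evs size_cat /=; lia.
have ix_x : index x vs = size s1.
  have := uniq_vs; rewrite evs cat_uniq => /and3P[_ /hasPn h _].
  by rewrite index_cat (negbTE (h x _)) ?inE ?eqxx //= eqxx addn0.
have e_singles : tape_of (singles (rcons s1 x)) = tape_of (singles s1) ++ [:: size s1; n].
  rewrite /singles map_rcons -cats1 -cat_cons tape_of_cat; congr (_ ++ _).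
  by rewrite /tape_of /= ix_x.
steps; apply: wp_conseq (IH (rcons s1 x) _ _ _ _ _ _) _ => //=.
- by rewrite cat_rcons.
- by rewrite hA size_rcons.
- rewrite e_singles; apply/segment_cat; rewrite add0n -hE; split.
    apply: segment_ext hs => i; rewrite add0n -hE => hi.
    by rewrite /= !ifN //; lia.
  apply/segment_cons; rewrite /= ifN; last lia.
  rewrite eqxx hA; split=> //; apply/segment_cons; by rewrite /= eqxx.
- by rewrite -[RHS]/(size (tape_of (singles (rcons s1 x)))) e_singles size_cat hE addn2.
- by move=> k st' _ [hk h1 h2]; split=> //; lia.
Qed.

(** With the empty run there are [n + 1] initial runs, whence [n < 2 ^ d]. They and their sentinels
    fill [2 * n + 1] cells. *)
Lemma sort_spec st d : reg st rN = n -> reg st r0 = 0 -> reg st rE = 0 ->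
  reg st rI = 0 -> reg st rA = 0 -> n < 2 ^ d ->
  wpw sort_cmd (fun k st' =>
    [/\ k <= 16 * (d + 1) * (2 * n + 1) + 6 * n + 4,
        segment (arr st' aRuns) (reg st' rI) (rcons (map ix (sort hv vs)) n)
      & reg st' rJ = reg st' rI + n.+1]) st.
Proof.
move=> hN h0 hE hI hA hd.
have sz : size (tape_of (singles vs)) = 2 * n + 1.
  rewrite /singles size_tape_of_cons; elim: (vs) => // x s IH.
  by rewrite map_cons size_tape_of_cons [size [:: x]]/= [size (x :: s)]/=; lia.
steps; apply: wp_conseq (singletons_loop_spec (s1 := [::]) (s2 := vs) _ _ _ _ _) _ => //=.
- by apply/segment_cons; rewrite hE hN.
- by rewrite hE.
move=> k st' fr [hk hs hE']; steps.
have flat : flatten [seq [:: v] | v <- vs] = vs by elim: (vs) => //= x s ->.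
apply: wp_conseq (sort_loop_spec (d := d) (rs1 := [::])
   (rs2 := singles vs) (N := 2 * n + 1) _ _ _ _ _ _ _ _ _ _ _) _ => //=.
- by rewrite (frame_reg fr).
- by rewrite (frame_reg fr).
- by rewrite size_map; lia.
- by rewrite (frame_reg fr) //= hI.
- by rewrite hE' (frame_reg fr) //= hI.
- by apply/allP => _ /mapP[v _ ->].
- by rewrite flat.
- exact: eq_leq sz.
- move=> k2 st2 _ [hk2 hs2 hJ2]; split=> //.
  apply: leq_trans (_ : 1 + 1 + k + (1 + (16 * (0 + d * (2 * n + 1)) + 16 * (2 * n + 1))) <= _).
    by lia.
  by move: hk; nia.
Qed.

(** * Neighbour stacks *)

Lemma segment_nth (a b c : seq nat) : segment (nth 0 (a ++ b ++ c)) (size a) b.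
Proof.
elim: b a => // x b IH a; apply/segment_cons; split.
  by rewrite nth_cat ltnn subnn.
by have := IH (rcons a x); rewrite size_rcons cat_rcons.
Qed.

Definition adjacency_arrays (start cells : nat -> nat) : Prop :=
  forall u, segment cells (start (ix u)) (map ix (adj u)) /\
            start (ix u).+1 = start (ix u) + size (adj u).

Lemma input_adjacency :
  adjacency_arrays (arr (input vs adj) aStart) (arr (input vs adj) aAdj).
Proof.
move=> u; pose lists := [seq map ix (adj v) | v <- vs].
have -> : arr (input vs adj) aStart =
  nth 0 (mkseq (fun i => sumn (take i (shape lists))) n.+1) by [].
have -> : arr (input vs adj) aAdj = nth 0 (flatten lists) by [].
pose i := index u vs; have hi : i < n := ix_lt u.
have hs : size (shape lists) = n by rewrite !size_map.
rewrite !nth_mkseq ?ltnS ?(ltnW hi) //.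
have eu : nth [::] lists i = map ix (adj u).
  by rewrite (nth_map u) // nth_index ?mem_vs.
have el : lists = take i lists ++ map ix (adj u) :: drop i.+1 lists.
  by rewrite -eu -drop_nth ?size_map // cat_take_drop.
split.
  rewrite [X in nth 0 (flatten X)]el flatten_cat /=.
  have -> : sumn (take i (shape lists)) = size (flatten (take i lists)).
    by rewrite size_flatten /shape map_take.
  exact: segment_nth.
rewrite (take_nth 0) ?hs // sumn_rcons; congr (_ + _).
by rewrite (nth_map [::]) ?size_map // eu size_map.
Qed.

(** Links point to smaller addresses, as cells are allocated in increasing order. Writing a cell
    above the head therefore cannot disturb the list. *)
Fixpoint chain (owner next : nat -> nat) h (s : seq V) : Prop :=
  if s is x :: s' then
    [/\ owner h = ix x, next h < h & chain owner next (next h) s']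
  else h = 0.

Arguments chain : simpl never.

Lemma chain_cons owner next h x (s : seq V) :
  chain owner next h (x :: s) <->
  [/\ owner h = ix x, next h < h & chain owner next (next h) s].
Proof. by []. Qed.

Lemma chain_upd owner next h (s : seq V) t a b : h < t ->
  chain owner next h s -> chain (upd owner t a) (upd next t b) h s.
Proof.
elim: s h => // x s IH h ht /chain_cons[h1 h2 h3]; apply/chain_cons.
by rewrite /= !(ltn_eqF ht); split=> //; apply: IH => //; apply: ltn_trans ht.
Qed.

Lemma chain_owner owner next h (s : seq V) : owner 0 = n ->
  chain owner next h s -> owner h = if s is x :: _ then ix x else n.
Proof. by move=> h0; case: s => [|x s] => [->|/chain_cons[]]. Qed.

Definition stacks (a : nat -> nat -> nat) (S : V -> seq V) : Prop :=
  a aOwner 0 = n /\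
  forall v, chain (a aOwner) (a aNext) (a aHead (ix v)) (S v).

(** With [t] the allocation counter, this makes the next cell fresh for every stack at once. *)
Definition heads_le (a : nat -> nat -> nat) t : Prop :=
  forall v, a aHead (ix v) <= t.

Lemma push_loop_spec u (l : seq V) (S : V -> seq V) st :
  reg st rU = ix u -> segment (arr st aAdj) (reg st rP) (map ix l) ->
  reg st rQ = reg st rP + size l -> uniq l ->
  stacks (arr st) S -> heads_le (arr st) (reg st rT) ->
  wpw push_loop (fun k st' =>
    [/\ k <= 8 * size l + 1,
        stacks (arr st') (fun v => if v \in l then u :: S v else S v)
      & heads_le (arr st') (reg st' rT)]) st.
Proof.
elim: l S st => [|x l IH] S st hU hs hQ hu hS hT.
  apply: wp_while_end => //=; rewrite hQ /=; lia.
move: hs hu hQ; rewrite /= => /segment_cons[h1 h2] /andP[nx hu] hQ.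
apply: wp_while_loop; first by rewrite /=; lia.
case: hS => [h0 hS].
steps.
apply: wp_conseq (IH (fun v => if v == x then u :: S v else S v) _ _ _ _ _ _ _) _ => //=.
- lia.
- split=> //= v; rewrite h1 ix_eq; case: (eqVneq v x) => [->|nvx].
    apply/chain_cons; rewrite /= eqxx; split=> //; first by rewrite ltnS.
    by apply: chain_upd; rewrite ?ltnS.
  by apply: chain_upd; rewrite ?ltnS.
- move=> v; rewrite /= h1 ix_eq; case: (eqVneq v x) => // _.
  exact: leqW.
- move=> k st' _ [hk [h0' hS'] hT']; split=> //; first lia.
  split=> // v; have := hS' v; rewrite inE.
  by case: (eqVneq v x) => [->|//]; rewrite (negbTE nx).
Qed.

(** The induction peels [l] from its end, following the loop. Each stack comes out as a filter of
    the queue, which is what makes it sorted. *)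
Lemma stacks_loop_spec (l : seq V) (S : V -> seq V) st :
  segment (arr st aRuns) (reg st rI) (map ix l) ->
  reg st rK = reg st rI + size l ->
  adjacency_arrays (arr st aStart) (arr st aAdj) ->
  stacks (arr st) S -> heads_le (arr st) (reg st rT) ->
  wpw stacks_loop (fun k st' =>
    [/\ k <= 8 * sumn [seq size (adj x) | x <- l] + 8 * size l + 1
      & stacks (arr st') (fun v => [seq x <- l | v \in adj x] ++ S v)]) st.
Proof.
elim/last_ind: l S st => [|l x IH] S st hs hK ha hS hT.
  by apply: wp_while_end => //=; rewrite hK addn0 ltnn.
move: hs hK; rewrite map_rcons size_rcons -cats1 => /segment_cat[h1].
rewrite size_map => /segment_cons[h2 _] hK.
apply: wp_while_loop; first by rewrite /= hK; lia.
have [hx1 hx2] := ha x.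
steps.
have eK : (reg st rK).-1 = reg st rI + size l by lia.
apply: wp_conseq (push_loop_spec (u := x) (l := adj x) (S := S) _ _ _ _ _ _) _ => //=.
- by rewrite eK h2.
- by rewrite eK h2.
- by rewrite eK h2.
- by case: adjP => _ /(_ x)[].
move=> k st' fr [hk hS' hT'].
apply: wp_conseq (IH _ _ _ _ _ hS' hT') _.
- by rewrite (frame_arr fr) // (frame_reg fr).
- by rewrite !(frame_reg fr).
- by rewrite !(frame_arr fr).
move=> k' st2 _ [hk' [h0 hS2]]; split.
  by rewrite map_rcons sumn_rcons; lia.
split=> // v; have := hS2 v; rewrite filter_rcons.
by case: ifP; rewrite ?cat_rcons.
Qed.

Definition dead_array (a : nat -> nat -> nat) (al : pred V) : Prop :=
  a aDead n = 0 /\ forall x, (a aDead (ix x) == 0) = al x.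

Lemma pop_loop_spec (al : pred V) (s : seq V) st :
  reg st r0 = 0 -> dead_array (arr st) al -> arr st aOwner 0 = n ->
  chain (arr st aOwner) (arr st aNext) (reg st rH) s ->
  reg st rX = arr st aOwner (reg st rH) -> reg st rD = arr st aDead (reg st rX) ->
  wpw pop_loop (fun k st' => exists s1 s2,
    [/\ s = s1 ++ s2, k <= 4 * size s1 + 1,
        chain (arr st aOwner) (arr st aNext) (reg st' rH) s2,
        all (predC al) s1
      & if s2 is x :: _ then reg st' rX = ix x /\ al x else reg st' rX = n]) st.
Proof.
move=> h0 [hdn hd] ho; elim: s st h0 hdn hd ho => [|x s IH] st h0 hdn hd ho hc hX hD.
  have eX : reg st rX = n by rewrite hX (chain_owner ho hc).
  apply: wp_while_end; first by rewrite /= hD eX hdn h0.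
  by exists [::], [::].
have eX : reg st rX = ix x by rewrite hX (chain_owner ho hc).
case: (boolP (al x)) => ax.
  apply: wp_while_end; first by rewrite /= hD eX h0 hd ax.
  by exists [::], (x :: s).
apply: wp_while_loop; first by rewrite /= hD eX h0 hd ax.
case/chain_cons: hc => h1 h2 h3.
steps; apply: wp_conseq (IH _ _ _ _ _ _ _ _) _ => //=.
move=> k st' _ [s1 [s2 [-> hk hc ha h]]]; exists (x :: s1), s2; split=> //=.
  by lia.
by rewrite ax.
Qed.

Definition upd_stack (S : V -> seq V) b s : V -> seq V :=
  fun v => if v == b then s else S v.

Lemma pop_spec (al : pred V) (S : V -> seq V) b st :
  reg st r0 = 0 -> dead_array (arr st) al -> stacks (arr st) S -> reg st rM = ix b ->
  wpw pop (fun k st' => exists s1 s2,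
    [/\ S b = s1 ++ s2, k <= 4 * size s1 + 5,
        stacks (arr st') (upd_stack S b s2), all (predC al) s1
      & if s2 is x :: _ then reg st' rX = ix x /\ al x else reg st' rX = n]) st.
Proof.
move=> h0 hd [ho hS] hM; have hSb := hS b.
steps; apply: wp_conseq (pop_loop_spec (al := al) (s := S b) _ _ _ _ _ _) _ => //=.
  by rewrite hM.
move=> k st' fr [s1 [s2 [e hk hc ha h]]]; steps.
exists s1, s2; split=> //; first lia.
have fa a : arr st' a = arr st a by rewrite (frame_arr fr).
split=> /=; first by rewrite fa.
move=> v; rewrite !fa (frame_reg fr) //= hM ix_eq /upd_stack.
by case: (eqVneq v b).
Qed.

(** * Searching and augmenting *)

Definition code (o : option V) : nat := if o is Some x then ix x else n.

(** [None] is a last element added to the order, matching the sentinel, so the search can start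
    without a candidate and needs no special case. *)
Definition beforeo (o o' : option V) : bool :=
  match o, o' with
  | Some u, Some v => hv u v
  | None, Some _ => false
  | _, None => true
  end.

Lemma beforeb_code o o' : beforeb (code o) (code o') = beforeo o o'.
Proof.
case: o o' => [u|] [v|] /=; rewrite ?beforeb_ix ?beforeb_n ?n_beforeb //.
by rewrite /beforeb lexx ltnn.
Qed.

Lemma beforeo_trans : transitive beforeo.
Proof. by case=> [v|] [u|] [x|] //=; apply: hv_trans. Qed.

Lemma beforeo_total : total beforeo.
Proof. by case=> [v|] [u|] //=; apply: hv_total. Qed.

Lemma code_eq_n o : (code o == n) = (o == None).
Proof. by case: o => [x|]; rewrite /= ?eqxx ?ix_neq. Qed.

Lemma mem_adj u v : (v \in adj u) = ([set u; v] \in E).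
Proof. by case: adjP => _ /(_ u)[]. Qed.

Lemma mate_arrayP (M : {set {set V}}) a v : matching E M -> mate_array vs M a ->
  (unmatched M v /\ a (ix v) = 0) \/
  (exists b, [set v; b] \in M /\ a (ix v) = (ix b).+1).
Proof.
move=> [sub _] hm; have [um|] := boolP (unmatched M v).
  by left; split=> //; apply: (hm v).1.
move=> nu; right; have [b hb|hno] := pickP (fun b => [set v; b] \in M).
  by exists b; split=> //; apply: (hm v).2.
by case/negP: nu; apply/(unmatchedP simpE _ sub) => b; rewrite hno.
Qed.

Lemma mate_arrayI (M : {set {set V}}) a : matching E M ->
  (forall v, (unmatched M v /\ a (ix v) = 0) \/
     (exists b, [set v; b] \in M /\ a (ix v) = (ix b).+1)) ->
  mate_array vs M a.
Proof.
move=> [_ mM] h v; split=> [um|x vx].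
  case: (h v) => [[]//|[b [vb _]]].
  by have [] := unmatched_edge vb; rewrite um.
case: (h v) => [[um _]|[b [vb ->]]]; last by rewrite (mM _ _ _ vb vx).
by have [] := unmatched_edge vx; rewrite um.
Qed.

Lemma mate_augment1 (M : {set {set V}}) a u v : matching E M ->
  short_path E M u [:: v] -> mate_array vs M a ->
  mate_array vs (augment M u [:: v])
    (upd (upd a (ix v) (ix u).+1) (ix u) (ix v).+1).
Proof.
move=> hM hp ha; have [sub _] := hM; have uu : unmatched M u by inversion hp.
apply: mate_arrayI => [|x]; first exact: augment_matching.
rewrite /= !ix_eq; case: (eqVneq x u) => [->|xu].
  by right; exists v; split=> //; rewrite (mem_augment1 simpE) // eqxx.
case: (eqVneq x v) => [->|xv].
  by right; exists u; split=> //; rewrite (mem_augment1 simpE) // setUC eqxx.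
have [[um ->]|[b [xb ->]]] := mate_arrayP x hM ha; [left|right].
  by rewrite (augment_unmatched simpE) // um xu xv.
by exists b; rewrite (mem_augment1 simpE) // xb orbT.
Qed.

Lemma mate_augment3 (M : {set {set V}}) f u a b c : matching E M ->
  short_path E M u [:: a; b; c] -> mate_array vs M f ->
  mate_array vs (augment M u [:: a; b; c])
    (upd (upd (upd (upd f (ix a) (ix u).+1) (ix u) (ix a).+1)
       (ix c) (ix b).+1) (ix b) (ix c).+1).
Proof.
move=> hM hp ha; have [sub _] := hM.
apply: mate_arrayI => [|x]; first exact: augment_matching.
rewrite /= !ix_eq; case: (eqVneq x b) => [->|xb].
  by right; exists c; split=> //; rewrite (mem_augment3 simpE) // eqxx orbT.
case: (eqVneq x c) => [->|xc].
  by right; exists b; split=> //; rewrite (mem_augment3 simpE) // (setUC [set c]) eqxx orbT.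
case: (eqVneq x u) => [->|xu].
  by right; exists a; split=> //; rewrite (mem_augment3 simpE) // eqxx.
case: (eqVneq x a) => [->|xa].
  by right; exists u; split=> //; rewrite (mem_augment3 simpE) // setUC eqxx.
have [[um ->]|[y [xy ->]]] := mate_arrayP x hM ha; [left|right].
  by rewrite (augment_unmatched simpE) // um xu xc.
exists y; rewrite (mem_augment3 simpE) // xy !set2_eq.
by rewrite (negbTE xa) (negbTE xb) /= !orbT.
Qed.

(** [al] is the current queue. An unmatched vertex outside it was handled without success and has
    had no short path since. *)
Definition alive_inv (M : {set {set V}}) (al : pred V) : Prop :=
  (forall x, al x -> unmatched M x) /\
  (forall x, unmatched M x -> al x \/ failed E M x).

(** Deletion being lazy, a stack is only squeezed between the alive neighbours and all neighbours.
    Shrinking [al] thus preserves the invariant at no cost. *)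
Definition stack_inv (S : V -> seq V) (al : pred V) : Prop :=
  forall v, [/\ sorted hv (S v), forall x, x \in S v -> [set v; x] \in E
              & forall x, al x -> [set v; x] \in E -> x \in S v].

(** Each discarded entry lowers it by one and costs the four steps of one round of [pop_loop]. *)
Definition potential (S : V -> seq V) : nat := \sum_(v : V) size (S v).

Lemma potential_upd S b s1 s2 : S b = s1 ++ s2 ->
  potential (upd_stack S b s2) + size s1 = potential S.
Proof.
move=> e; rewrite /potential (bigD1 b) //= [RHS](bigD1 b) //= e size_cat.
rewrite /upd_stack eqxx (eq_bigr (fun v => size (S v))); first by lia.
by move=> v /negbTE->.
Qed.

Lemma stack_inv_upd S al b s1 s2 : S b = s1 ++ s2 -> all (predC al) s1 ->
  stack_inv S al -> stack_inv (upd_stack S b s2) al.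
Proof.
move=> e hall hS v; rewrite /upd_stack; case: (eqVneq v b) => [->|_]; last exact: hS.
have [h1 h2 h3] := hS b; rewrite e in h1 h2 h3; split.
- by rewrite (subseq_sorted hv_trans (suffix_subseq _ _) h1).
- by move=> x xs; apply: h2; rewrite mem_cat xs orbT.
- move=> x ax bx; have := h3 x ax bx; rewrite mem_cat => /orP[xs|//].
  by have := allP hall x xs; rewrite /= ax.
Qed.

Definition without (al : pred V) u : pred V := fun x => al x && (x != u).

(** The end is unmatched, hence alive or failed, and the reversed path shows that it has not
    failed. *)
Lemma last_alive M u s al : alive_inv M al -> short_path E M u s ->
  without al u (last u s).
Proof.
move=> [_ h] hp; have [ul nu] := short_path_last simpE hp.
rewrite /without nu andbT; have [//|fl] := h _ ul.
by have [s' [hs' _]] := short_path_rev hp; case: (fl s').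
Qed.

(** [o] is a best end among the paths whose first step goes to [v]. Paths are nonempty, so the
    default of [head] is never reached. *)
Definition candidate (M : {set {set V}}) u v (o : option V) : Prop :=
  (if o is Some x then
     exists s, [/\ short_path E M u s, head u s = v & last u s = x]
   else True) /\
  (forall s, short_path E M u s -> head u s = v -> beforeo o (Some (last u s))).

Lemma candidate_spec M u v al S st :
  reg st r0 = 0 -> reg st rV = ix v -> reg st rM = arr st aMate (ix v) ->
  matching E M -> mate_array vs M (arr st aMate) -> alive_inv M al ->
  dead_array (arr st) (without al u) -> stacks (arr st) S ->
  stack_inv S (without al u) -> unmatched M u -> [set u; v] \in E ->
  wpw (If (TEq rM r0) (Copy rX rV) (Decr rM;; pop)) (fun k st' => exists o S',
    [/\ reg st' rX = code o, candidate M u v o, stacks (arr st') S',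
        stack_inv S' (without al u) & k + 4 * potential S' <= 4 * potential S + 7]) st.
Proof.
move=> h0 hV hMr hM hm hal hd hS hSi uu uv; apply: wp_if.
have [sub mM] := hM.
have [[uv' em]|[b [vb em]]] := mate_arrayP v hM hm.
  rewrite ifT; last by rewrite /= hMr em h0.
  apply: wp_do; exists (Some v), S; split=> //; last lia.
  split; first by exists [:: v]; split=> //; constructor.
  move=> s [x _ _ _ /= ->|a b c _ ab _ _ _ _ /= ea]; first by have := hv_total v v; rewrite orbb.
  by have [] := unmatched_edge ab; rewrite ea uv'.
rewrite ifF; last by rewrite /= hMr em h0.
apply: wp_seq; apply: wp_do.
apply: wp_conseq (pop_spec (al := without al u) (S := S) (b := b) _ _ _ _) _ => //=.
  by rewrite hMr em.
move=> k st' _ [s1 [s2 [e hk hS' hall hX]]].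
have hSi' := stack_inv_upd e hall hSi.
have hpot := potential_upd e.
have [srt nbr mem] := hSi' b; rewrite /upd_stack eqxx in srt nbr mem.
(* The matched vertex [v] has [b] as its only partner, so every path through it is [v, b, c]. Its
   end [c] is alive, hence survives on the popped stack of [b]. *)
have via s : short_path E M u s -> head u s = v ->
    exists2 c, s = [:: v; b; c] & last u s \in s2.
  move=> hp hh; have al_l := last_alive hal hp.
  case: hp hh al_l => [x ux _ ux' /= exv|a b' c ua ab bc _ uc cu /= ea] al_l.
    by have [] := unmatched_edge vb; rewrite -exv ux'.
  rewrite ea in ab *; have eb := mM _ _ _ vb ab; rewrite -eb in bc *.
  by exists c => //; apply: mem.
case: s2 => [|x s2] in hX e hS' hSi' hpot srt nbr mem via *.
  exists None, (upd_stack S b [::]); split=> //; last by lia.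
  by split=> // s hp /(via _ hp)[].
case: hX => hX ax; exists (Some x), (upd_stack S b (x :: s2)); split=> //; last by lia.
(* The condition that the end differs from [u] holds because [u] is already excluded from the alive
   vertices. *)
move: ax => /andP[ax xu]; split.
  exists [:: v; b; x]; split=> //; apply: ShortPath3 => //.
    by apply: nbr; rewrite inE eqxx.
  by apply: hal.1.
move=> s hp hh; have [c _ hl] := via s hp hh.
move: srt; rewrite (sorted_pairwise hv_trans) /= => /andP[/allP hmin _].
move: hl; rewrite inE => /orP[/eqP->|/hmin //].
by have := hv_total x x; rewrite orbb.
Qed.

Definition found (M : {set {set V}}) u (o : option V) via : Prop :=
  if o is Some x then
    exists s, [/\ short_path E M u s, via = ix (head u s) & last u s = x]
  else True.

(** The induction carries [o] as the best end over the paths whose first inner vertex is no longer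
    in the remaining list [l]. *)
Lemma search_loop_spec M u al (l : seq V) S o st :
  reg st r0 = 0 -> segment (arr st aAdj) (reg st rP) (map ix l) ->
  reg st rQ = reg st rP + size l -> {subset l <= adj u} ->
  matching E M -> mate_array vs M (arr st aMate) -> alive_inv M al ->
  dead_array (arr st) (without al u) -> stacks (arr st) S ->
  stack_inv S (without al u) -> unmatched M u ->
  reg st rBest = code o -> found M u o (reg st rVia) ->
  (forall s, short_path E M u s -> head u s \notin l ->
     beforeo o (Some (last u s))) ->
  wpw search_loop (fun k st' => exists o' S',
    [/\ reg st' rBest = code o', found M u o' (reg st' rVia),
        forall s, short_path E M u s -> beforeo o' (Some (last u s)),
        stacks (arr st') S' /\ stack_inv S' (without al u)
      & k + 4 * potential S' <= 4 * potential S + 15 * size l + 1]) st.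
Proof.
elim: l S o st => [|v l IH] S o st h0 hs hQ hl hM hm hal hd hS hSi uu hB hf hb.
  apply: wp_while_end; first by rewrite /= hQ addn0 ltnn.
  by exists o, S; split=> //; [move=> s hp; apply: hb | lia].
move: hs; rewrite /= => /segment_cons[hv1 hs].
apply: wp_while_loop; first by rewrite /= hQ /=; lia.
steps.
have uv : [set u; v] \in E by rewrite -mem_adj hl // inE eqxx.
apply: wp_conseq (candidate_spec (M := M) (u := u) (v := v) (al := al) (S := S)
  _ _ _ _ _ _ _ _ _ _ _) _ => //=.
  by rewrite hv1.
move=> k1 st1 fr1 [x [S1 [hX [hc1 hc2] hS1 hSi1 hk1]]].
have hif : wpw (If (before rX rBest) (Copy rBest rX;; Copy rVia rV) (Copy rS rS))
  (fun k2 st2 => k2 <= 3 /\ exists o', [/\ beforeo o' x, beforeo o' o,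
     reg st2 rBest = code o' & found M u o' (reg st2 rVia)]) st1.
  apply: wp_if; rewrite eval_before hX (frame_reg fr1) //= hB beforeb_code.
  case: ifP => hx; steps; split=> //; [exists x|exists o]; split=> //.
  - by have := beforeo_total x x; rewrite orbb.
  - case: (x) hc1 => // y [s [hp hh hls]]; exists s; split=> //.
    by rewrite (frame_reg fr1) //= hv1 hh.
  - by have := beforeo_total o x; rewrite hx orbF.
  - by have := beforeo_total o o; rewrite orbb.
  - by rewrite (frame_reg fr1).
  - by rewrite (frame_reg fr1).
apply: wp_seq; apply: wp_conseq hif _.
move=> k2 st2 fr2 [hk2 [o' [h1 h2 hB2 hf2]]]; steps.
apply: wp_conseq (IH S1 o' _ _ _ _ _ _ _ _ _ _ _ _ _ _ _) _ => //=.
- by rewrite (frame_reg fr2) // (frame_reg fr1).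
- by rewrite (frame_reg fr2) // (frame_reg fr1) // (frame_arr fr2) // (frame_arr fr1).
- by rewrite !(frame_reg fr2) // !(frame_reg fr1) //= hQ /=; lia.
- by move=> y yl; apply: hl; rewrite inE yl orbT.
- by rewrite (frame_arr fr2) // (frame_arr fr1).
- by case: hd => hd1 hd2; split=> [|y]; rewrite (frame_arr fr2) // (frame_arr fr1) //= hd2.
- by case: hS1 => hS1 hS2; split=> [|y]; rewrite !(frame_arr fr2).
- move=> s hp hh; have [ev|nv] := eqVneq (head u s) v.
    exact: beforeo_trans h1 (hc2 s hp ev).
  by apply: beforeo_trans h2 (hb s hp _); rewrite inE negb_or nv.
- move=> k3 st3 _ [o3 [S3 [g1 g2 g3 g4 g5]]]; exists o3, S3; split=> //.
  by lia.
Qed.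

Lemma augment_cmd_spec M u s al st :
  reg st rN = n -> reg st r0 = 0 -> reg st rU = ix u ->
  matching E M -> mate_array vs M (arr st aMate) -> dead_array (arr st) al ->
  short_path E M u s -> reg st rBest = ix (last u s) ->
  reg st rVia = ix (head u s) ->
  wpw augment_cmd (fun k st' =>
    [/\ k <= 30, mate_array vs (augment M u s) (arr st' aMate),
        dead_array (arr st') (without al (last u s))
      & tape st' = tape st ++ size s :: map ix s]) st.
Proof.
move=> hN h0 hU hM hm [hd1 hd2] hp hB hV.
have hd : dead_array (upd (arr st) aDead (upd (arr st aDead) (ix (last u s)) 1))
    (without al (last u s)).
  split=> [|x] /=; first by rewrite eq_sym ix_neq.
  by rewrite ix_eq /without; case: (eqVneq x (last u s)); rewrite ?andbF ?andbT ?hd2.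
steps; apply: wp_if; rewrite /= hV.
case: hp (hp) hB hV hd => [v uv uu uv' hp|a b c ua ab bc uu uc cu hp] /= hB hV hd.
  have -> : arr st 2 (index v vs) = 0 by apply: (hm v).1.
  rewrite h0 eqxx; steps; split=> //.
  - by rewrite hU hB; apply: mate_augment1.
  - by move: hd; rewrite -hB.
  - by rewrite hB -!cats1 -!catA.
have -> : arr st 2 (index a vs) = (index b vs).+1 by apply: (hm a).2.
rewrite h0 /=; steps; split=> //.
- by rewrite hU hB hV; apply: mate_augment3.
- by move: hd; rewrite -hB.
- by rewrite hB hV -!cats1 -!catA.
Qed.

(** * One iteration and the main loop *)

Definition invariant (a : nat -> nat -> nat) M al S : Prop :=
  [/\ matching E M, mate_array vs M (a aMate), dead_array a al, stacks a S
    & stack_inv S al /\ alive_inv M al].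

Lemma stack_inv_sub S (al al' : pred V) : (forall x, al' x -> al x) ->
  stack_inv S al -> stack_inv S al'.
Proof.
move=> sub h v; have [h1 h2 h3] := h v; split=> // x /sub; exact: h3.
Qed.

Lemma handle_spec (M : {set {set V}}) u (al : pred V) (S : V -> seq V) st :
  reg st rN = n -> reg st r0 = 0 -> reg st rU = ix u -> al u ->
  adjacency_arrays (arr st aStart) (arr st aAdj) ->
  invariant (arr st) M al S ->
  wpw handle (fun k st' => exists s M' al' S',
    [/\ invariant (arr st') M' al' S',
        tape st' = tape st ++ [:: ix u, size s & map ix s],
        k + 4 * potential S' <= 4 * potential S + 15 * size (adj u) + 50
      & [/\ s = [::], M' = M, al' = without al u &
            forall s', ~~ short_augmenting E M u s'] \/
        [/\ short_augmenting E M u s, M' = augment M u s,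
            al' = without (without al u) (last u s) &
            forall s', short_augmenting E M u s' -> hv (last u s) (last u s')]]) st.
Proof.
move=> hN h0 hU au hadj [hM hm hd hS [hSi hal]].
have [sub _] := hM; have [hal1 hal2] := hal.
have uu : unmatched M u := hal1 _ au.
have [ha1 ha2] := hadj u.
have hSi' : stack_inv S (without al u).
  by apply: stack_inv_sub hSi => x /andP[].
steps.
apply: wp_conseq (search_loop_spec (M := M) (u := u) (al := al) (l := adj u)
  (S := S) (o := None) _ _ _ _ _ _ _ _ _ _ _ _ _ _) _ => //=.
- by rewrite hU.
- by rewrite hU ha2.
- case: hd => hd1 hd2; split=> [|x] /=; first by rewrite hU eq_sym ix_neq.
  by rewrite hU ix_eq /without; case: (eqVneq x u); rewrite ?andbF ?andbT ?hd2.
- by move=> s hp; case: hp => [v uv|a b c ua]; rewrite /= mem_adj ?uv ?ua.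
move=> k st1 fr1 [o [S1 [hB hf hb [hS1 hSi1] hk]]].
have fd : dead_array (arr st1) (without al u).
  case: hd => hd1 hd2; split=> [|x]; rewrite (frame_arr fr1) //= hU.
    by rewrite eq_sym ix_neq.
  by rewrite ix_eq /without; case: (eqVneq x u); rewrite ?andbF ?andbT ?hd2.
steps; apply: wp_if; rewrite /= hB (frame_reg fr1) //= hN code_eq_n.
case: o hB hf hb => [x|] /= hB hf hb; last first.
  steps; exists [::], M, (without al u), S1; split=> //.
  - split=> //; first by rewrite (frame_arr fr1).
    split=> //; split=> [y /andP[/hal1 //]|y um].
    (* Here [u] passes from alive to failed: nothing was found, although the result is at least as
       good as the end of any path. *)
    have [->|yu] := eqVneq y u; first by right=> s /hb.
    by case: (hal2 _ um) => h; [left; rewrite /without h yu|right].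
  - rewrite !(frame_reg fr1) //= (frame_tape fr1) //= hU h0.
    by rewrite -!cats1 -!catA.
  - by lia.
  - left; split=> // s; apply/negP => /(short_augmentingP simpE _ _ sub) hp.
    by have := hb _ hp.
case: hf => s [hp hvia hlast].
apply: wp_conseq (augment_cmd_spec (M := M) (u := u) (s := s)
  (al := without al u) _ _ _ _ _ _ _ _ _) _ => //=.
- by rewrite (frame_reg fr1).
- by rewrite (frame_reg fr1).
- by rewrite (frame_reg fr1).
- by rewrite (frame_arr fr1).
- by rewrite hlast.
move=> k2 st2 fr2 [hk2 hm2 hd2 ht2].
exists s, (augment M u s), (without (without al u) (last u s)), S1; split.
- split=> //; first exact: augment_matching.
    by case: hS1 => hS1 hS2; split=> [|v]; rewrite !(frame_arr fr2) //=; apply: hS2.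
  split; first by apply: stack_inv_sub hSi1 => y /andP[].
  split=> y.
    by rewrite /without (augment_unmatched simpE _ hp) // => /andP[/andP[/hal1-> ->]].
  move=> um; have := um; rewrite (augment_unmatched simpE _ hp) // => /and3P[um' yu yl].
  case: (hal2 _ um') => h; [left|right]; first by rewrite /without h yu yl.
  exact: (augment_failed simpE hM hp h).
- rewrite ht2 (frame_tape fr1) //= (frame_reg fr1) //= hU.
  by rewrite -cats1 -catA.
- by lia.
- right; split=> //; first exact/(short_augmentingP simpE).
  by move=> s' /(short_augmentingP simpE _ _ sub) hp'; rewrite hlast; apply: hb.
Qed.

Lemma encode_trace_cons u s tr :
  encode_trace vs ((u, s) :: tr) = [:: ix u, size s & map ix s] ++ encode_trace vs tr.
Proof. by []. Qed.

Lemma main_loop_spec (rest : seq V) (M : {set {set V}}) (al : pred V) (S : V -> seq V) st :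
  reg st rN = n -> reg st r0 = 0 ->
  segment (arr st aRuns) (reg st rK) (rcons (map ix rest) n) ->
  reg st rU = arr st aRuns (reg st rK) -> uniq rest ->
  adjacency_arrays (arr st aStart) (arr st aAdj) ->
  invariant (arr st) M al S ->
  wpw main_loop (fun k st' => exists tr M',
    [/\ run w E vs [seq x <- rest | al x] M tr M',
        tape st' = tape st ++ encode_trace vs tr,
        mate_array vs M' (arr st' aMate)
      & k <= 15 * sumn [seq size (adj x) | x <- rest] + 60 * size rest
             + 4 * potential S + 1]) st.
Proof.
elim: rest M al S st => [|u rest IH] M al S st hN h0 hs hU huniq hadj hinv.
  move: hs; rewrite /= => /segment_cons[hs _].
  apply: wp_while_end; first by rewrite /= hU hs hN eqxx.
  exists [::], M; split=> //; first exact: run_done.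
  - by rewrite cats0.
  - by case: hinv.
  - by rewrite /=; lia.
move: hs huniq; rewrite /= => /segment_cons[hu hs] /andP[nu huniq].
rewrite hu in hU.
apply: wp_while_loop; first by rewrite /= hU hN ix_neq.
have [hM hm [hd1 hd2] hS [hSi hal]] := hinv.
apply: wp_seq; apply: wp_do => /=; apply: wp_seq; apply: wp_if.
rewrite /= hU h0 hd2; case: (boolP (al u)) => au; last first.
  steps; apply: wp_conseq (IH M al S _ _ _ _ _ _ _ _) _ => //=.
  move=> k st' _ [tr [M' [h1 h2 h3 h4]]]; exists tr, M'; split=> //.
  by lia.
apply: wp_conseq (handle_spec (M := M) (u := u) (al := al) (S := S) _ _ _ _ _ _) _ => //=.
move=> k st1 fr1 [s [M1 [al1 [S1 [hinv1 ht1 hk1 hcase]]]]].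
have fN : reg st1 rN = n by rewrite (frame_reg fr1).
have f0 : reg st1 r0 = 0 by rewrite (frame_reg fr1).
have fK : reg st1 rK = reg st rK by rewrite (frame_reg fr1).
have fT : arr st1 aRuns = arr st aRuns by rewrite (frame_arr fr1).
have fS : arr st1 aStart = arr st aStart by rewrite (frame_arr fr1).
have fA : arr st1 aAdj = arr st aAdj by rewrite (frame_arr fr1).
steps; apply: wp_conseq (IH M1 al1 S1 _ _ _ _ _ _ _ _) _ => //=.
- by rewrite fT fK.
- by rewrite fS fA.
move=> k2 st2 _ [tr [M2 [hrun ht2 hm2 hk2]]]; exists ((u, s) :: tr), M2; split=> //.
(* As [u] does not recur in [rest], marking it dead leaves the filtered queue unchanged. As the
   queue has no repetition, [rem] of the matched end is again a filter. *)
- have eu : [seq x <- rest | al x] = [seq x <- rest | without al u x].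
    apply: eq_in_filter => x xr; rewrite /without.
    case: (eqVneq x u) => [ex|_]; last by rewrite andbT.
    by rewrite -ex xr in nu.
  have ul : uniq [seq x <- rest | without al u x] by rewrite filter_uniq.
  rewrite eu; case: hcase => [[es eM eal hno]|[hsa eM eal hmin]].
    by rewrite es; apply: run_fail => //; rewrite -eal -eM.
  apply: run_augment => //; rewrite rem_filter // -filter_predI -eM.
  rewrite (eq_filter (a2 := al1)) // => x.
  by rewrite eal /= /without andbC.
- by rewrite ht2 ht1 encode_trace_cons catA.
- by lia.
Qed.

(** * The running time *)

Lemma size_adj v : size (adj v) <= degree E v.
Proof.
case: adjP => _ /(_ v)[ua ha].
rewrite -(size_map (fun x => [set v; x])) /degree cardE.
apply: uniq_leq_size => [|e /mapP[x xv ->]].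
  rewrite map_inj_in_uniq // => x y _ _ /eqP.
  by rewrite set2_eq eqxx /= => /orP[/eqP //|/andP[/eqP-> /eqP->]].
by rewrite mem_enum inE -ha xv set21.
Qed.

Lemma sum_degree : \sum_(v : V) degree E v = 2 * #|E|.
Proof.
rewrite (eq_bigr (fun v => \sum_(e in E) (v \in e))); last first.
  move=> v _; rewrite /degree -sum1_card big_mkcond [RHS]big_mkcond /=.
  by apply: eq_bigr => e _; rewrite inE; case: (e \in E); case: (v \in e).
rewrite exchange_big /= (eq_bigr (fun=> 2)).
  by rewrite sum_nat_const mulnC.
by move=> e /simpE <-; rewrite -sum1_card [RHS]big_mkcond.
Qed.

(** The lists and the initial stacks each have total size at most [2 * #|E|]. The factor 54 is twice
    8 for pushing, 15 for searching and 4 for the potential; 74 is 6 for the singletons, 8 for the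
    stacks and 60 for the main loop. *)
Lemma two_thirds_cmd_spec d : n < 2 ^ d ->
  exists k, performs_two_thirds two_thirds_cmd E w vs adj k /\
    k <= 16 * (d + 1) * (2 * n + 1) + 74 * n + 54 * #|E| + 20.
Proof.
move=> hd; set L := sort hv vs.
have pL : perm_eq L (enum V) by rewrite perm_sort adjP.1.
have uL : uniq L by rewrite (perm_uniq pL) enum_uniq.
have sL : size L = n by rewrite size_sort.
have mL x : x \in L by rewrite (perm_mem pL) mem_enum.
have sumL : sumn [seq size (adj x) | x <- L] <= 2 * #|E|.
  rewrite sumnE big_map (perm_big _ pL) big_enum -sum_degree /=.
  by apply: leq_sum => v _; apply: size_adj.
pose S0 v := [seq x <- L | v \in adj x].
have potS : potential S0 <= 2 * #|E|.
  rewrite -sum_degree; apply: leq_sum => v _.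
  apply: leq_trans (size_adj v); apply: uniq_leq_size; first exact: filter_uniq.
  by move=> x; rewrite mem_filter !mem_adj setUC => /andP[].
suff [k [st [hex hQ]]] : wpw two_thirds_cmd (fun k st => exists tr M,
    [/\ two_thirds w E vs tr M, tape st = encode_trace vs tr,
      mate_array vs M (arr st aMate)
    & k <= 16 * (d + 1) * (2 * n + 1) + 74 * n + 54 * #|E| + 20]) (input vs adj).
  by case: hQ => tr [M [h1 h2 h3 h4]]; exists k; split=> //; exists st, tr, M.
apply: wp_seq; apply: wp_conseq (sort_spec (d := d) _ _ _ _ _ _) _ => //.
move=> k1 st1 fr1 [hk1 hs1 hJ1].
have fa a : a != aRuns -> arr st1 a = arr (input vs adj) a.
  by move=> ha; rewrite (frame_arr fr1) // !inE /=; case: a ha => [|[|[|[|]]]].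
move: (hs1); rewrite -cats1 => /segment_cat[hs1' _].
steps; apply: wp_conseq (stacks_loop_spec (l := L) (S := fun=> [::]) _ _ _ _ _) _ => //=.
- by rewrite hJ1 sL addnS.
- by rewrite !fa //; exact: input_adjacency.
- split=> /=; last by move=> v; rewrite !fa.
  by rewrite !(frame_reg fr1).
- by move=> v; rewrite /= !fa.
move=> k2 st2 fr2 [hk2 hS2]; steps.
have fa2 a : a != aRuns -> a < 5 -> arr st2 a = arr (input vs adj) a.
  by case: a => [|[|[|[|[|]]]]] // _ _; rewrite (frame_arr fr2) //= fa.
have hS : stacks (arr st2) S0.
  by case: hS2 => h1 h2; split=> // v; have := h2 v; rewrite cats0.
apply: wp_conseq (main_loop_spec (rest := L) (M := set0) (al := predT) (S := S0)
  _ _ _ _ _ _ _) _ => //=.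
- by rewrite (frame_reg fr2) //= (frame_reg fr1).
- by rewrite (frame_reg fr2) //= (frame_reg fr1).
- by rewrite (frame_arr fr2) // (frame_reg fr2).
- by rewrite !fa2 //; exact: input_adjacency.
- have um x : unmatched (set0 : {set {set V}}) x by rewrite /unmatched /cover big_set0 inE.
  split=> //=.
  + by split=> [|v x y]; rewrite ?sub0set // inE.
  + by move=> v; split=> [_|x]; rewrite ?inE // fa2.
  + by split=> [|x]; rewrite fa2.
  + split; last by split=> // x _; left.
    move=> v; split.
    * by apply: sorted_filter; [exact: hv_trans|apply: sort_sorted; exact: hv_total].
    * by move=> x; rewrite mem_filter mem_adj setUC => /andP[].
    * by move=> x _ vx; rewrite mem_filter mL mem_adj setUC vx.
move=> k3 st3 _ [tr [M [hrun ht hm hk3]]]; exists tr, M; split=> //.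
- by rewrite /two_thirds -/L -[L]filter_predT.
- by rewrite ht (frame_tape fr2) //= (frame_tape fr1).
- move: hk1 hk2 hk3 sumL potS; rewrite sL.
  move: (sumn _) (potential S0) #|E| (16 * _ * _) => A P m X; lia.
Qed.

Lemma cost_bound d k : 2 <= n -> 2 ^ d.-1 <= n ->
  k <= 16 * (d + 1) * (2 * n + 1) + 74 * n + 54 * #|E| + 20 ->
  (k%:R <= 300 / ln 2 *
     (#|E|%:R * ln (max_degree E)%:R + n%:R * ln n%:R) :> R)%R.
Proof.
move=> n2 hd hk.
have ln2 : (0 < ln 2 :> R)%R by apply: ln_gt0; rewrite ltr1n.
(* [y] is the binary logarithm of [n]; it is at least 1 since [n] is at least 2, so it absorbs all
   terms linear in [n] and the constant. *)
pose y : R := (ln n%:R / ln 2)%R.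
have y1 : (1 <= y)%R.
  by rewrite /y ler_pdivlMr // mul1r ler_ln ?posrE ?ltr0n ?ler_nat //; lia.
have dy : (d%:R <= y + 1)%R.
  suff h : (d.-1%:R <= y)%R.
    apply: le_trans (_ : (d.-1%:R + 1 <= _)%R); last by rewrite lerD2r.
    by rewrite natr1 ler_nat; lia.
  rewrite /y ler_pdivlMr // mulr_natl -lnXn ?ltr0n // -natrX.
  by rewrite ler_ln ?posrE ?ltr0n ?expn_gt0 ?ler_nat //; lia.
(* The term [27 * n] covers maximum degree at most 1, where the logarithm gives nothing; degree 0
   relies on the convention that [ln 0] is 0. *)
have em : (54 * #|E|%:R <= 54 * (#|E|%:R * ln (max_degree E)%:R) / ln 2 + 27 * n%:R :> R)%R.
  rewrite -!mulrA; set q := (ln (max_degree E)%:R / ln 2 : R)%R.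
  have [D1|D2] := leqP (max_degree E) 1.
    have q0 : (0 <= q)%R.
      rewrite divr_ge0 ?(ltW ln2) //; case: (max_degree E) => [|D].
        by rewrite ln0.
      by rewrite ln_ge0 // ler1n.
    have : 2 * #|E| <= n.
      rewrite -sum_degree (perm_size adjP.1) -cardE -sum1_card.
      apply: leq_sum => v _; apply: leq_trans D1.
      exact: (leq_bigmax (F := fun v => degree E v)).
    rewrite -(ler_nat R) natrM => h.
    have : (0 <= #|E|%:R * q :> R)%R by rewrite mulr_ge0.
    by lra.
  have q1 : (1 <= q)%R.
    by rewrite /q ler_pdivlMr // mul1r ler_ln ?posrE ?ltr0n ?ler_nat //; lia.
  have : (#|E|%:R <= #|E|%:R * q :> R)%R by rewrite ler_peMr.
  have : (0 <= n%:R :> R)%R by [].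
  by lra.
have nR : (2%:R <= n%:R :> R)%R by rewrite ler_nat.
have hk' : (k%:R <= 16 * (d%:R + 1) * (2 * n%:R + 1) + 74 * n%:R + 54 * #|E|%:R + 20 :> R)%R.
  by move: hk; rewrite -(ler_nat R) !(natrD, natrM).
have -> : (300 / ln 2 * (#|E|%:R * ln (max_degree E)%:R + n%:R * ln n%:R) =
   300 * (#|E|%:R * ln (max_degree E)%:R / ln 2) + 300 * (n%:R * y) :> R)%R.
  by rewrite /y; field; rewrite gt_eqF.
have ny : (n%:R <= n%:R * y)%R by rewrite ler_peMr.
have nd : ((d%:R + 1) * n%:R <= 3 * (n%:R * y) :> R)%R.
  rewrite (_ : 3 * (n%:R * y) = 3 * y * n%:R)%R; last by ring.
  by rewrite ler_wpM2r //; lra.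
have d0 : (0 <= d%:R :> R)%R by [].
have nd2 : ((d%:R + 1) * 2 <= (d%:R + 1) * n%:R :> R)%R.
  by rewrite ler_wpM2l //; lra.
have q0 : (0 <= #|E|%:R * ln (max_degree E)%:R / ln 2 :> R)%R.
  rewrite divr_ge0 ?(ltW ln2) // mulr_ge0 //; case: (max_degree E) => [|D].
    by rewrite ln0.
  by rewrite ln_ge0 // ler1n.
by lra.
Qed.

End Machine.

Theorem theorem1 (R : realType) :
  exists (c : cmd) (C : R),
  forall (V : finType) (E : {set {set V}}) (w : V -> R)
         (vs : seq V) (adj : V -> seq V),
    simple_graph E ->
    (forall v : V, (0 <= w v)%R) ->
    adjacency_lists E vs adj ->
    exists k : nat,
      performs_two_thirds c E w vs adj k /\
      (2 <= #|V| ->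
       (k%:R <= C * (#|E|%:R * ln (max_degree E)%:R + #|V|%:R * ln #|V|%:R))%R).
Proof.
exists two_thirds_cmd, (300 / ln 2)%R => V E w vs adj simpE w_ge0 adjP.
have eV : #|V| = size vs by rewrite cardE (perm_size adjP.1).
(* The number [d] of passes is the rounded up binary logarithm of [n + 1], which gives both
   [n < 2 ^ d] and [2 ^ d.-1 <= n]. *)
have [k [hk hle]] := two_thirds_cmd_spec simpE w_ge0 adjP (up_logP (size vs).+1 (ltnSn 1)).
exists k; split=> //; rewrite eV => n2; apply: (cost_bound R simpE adjP n2 _ hle).
by have /andP[+ _] := up_log_bounds (ltnSn 1) (leqW n2); rewrite ltnS.
Qed.
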